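(* Let $Q_0=[0,1]^d\subset\mathbb R^d$, let $\Phi=\{\varphi_j\}_{j\in\mathbb N}$ be a countable dense subset of $\{\varphi\in C_c^\infty(Q_0):\|\varphi\|_\infty\le1\}$, let $\mathcal F:=\Phi^{d+1}\subset (BV(Q_0))^*$, and let $W(Q_0):=\mathrm{cl}_{(BV(Q_0))^*}(\mathrm{span}\,\mathcal F)$. Then the space $W(Q_0)$ is not a strongly unique predual.
   Context: All Banach spaces are real. $BV(Q_0)=\{u\in L^1(Q_0):V[u]<\infty\}$, where $V[u]:=\sup\{\int_{Q_0}u\,\mathrm{div}\varphi\,dx:\varphi\in C_0^\infty(Q_0)^d,\ \|\varphi\|_\infty\le1\}$ and $\|\varphi\|_\infty=\max_i\sup|\varphi_i|$ for vector fields, with norm $\|u\|_{BV}:=\|u\|_{L^1}+V[u]$. $C_c^\infty(Q_0)=C_0^\infty(Q_0)$ denotes smooth functions with compact support in the interior of $Q_0$, and $C_0(Q_0)$ the continuous functions on the interior of $Q_0$ vanishing at the boundary (at infinity); density in the definition of $\Phi$ is with respect to the supremum norm. A $(d+1)$-tuple $(\varphi_0,\varphi_1,\dots,\varphi_d)$ of functions in $C_c^\infty(Q_0)$ is identified with the element of $(BV(Q_0))^*$ given by $u\mapsto\int_{Q_0}u\varphi_0\,dx+\sum_{i=1}^d\int_{Q_0}u\,\frac{\partial\varphi_i}{\partial x_i}\,dx$. With these identifications $\mathcal F$ is norming for $BV(Q_0)$ and $W(Q_0)=\{\varphi+\mathrm{div}\,\phi:\varphi\in C_0(Q_0),\ \phi\in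 C_0(Q_0;\mathbb R^d)\}$ (as a vector space) is an isometric predual of $BV(Q_0)$, i.e. $W(Q_0)^*\cong BV(Q_0)$ via the pairing of $(BV(Q_0))^*$ with $BV(Q_0)$, so that $W(Q_0)^{**}$ is identified with $(BV(Q_0))^*$. A Banach space $Y$ is a strongly unique (isometric) predual if, whenever $P\subset Y^{**}$ is a closed subspace such that $P^*\cong Y^*$ via the duality induced by $Y^*$ (i.e. the map $Y^*\to P^*$, $y^*\mapsto(p\mapsto p(y^* ))$, is an isometric isomorphism), $P$ coincides with the canonical copy of $Y$ in $Y^{**}$. *)

(* Defs.v *)
From HB Require Import structures.
From mathcomp Require Import all_boot all_order all_algebra.
From mathcomp Require Import generic_quotient ring_quotient.
From mathcomp Require Import all_classical all_reals all_analysis.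
From mathcomp Require Import measurable_realfun.
Set Implicit Arguments. Unset Strict Implicit. Unset Printing Implicit Defensive.
Import Order.TTheory GRing.Theory Num.Theory.
Import numFieldNormedType.Exports.
Local Open Scope classical_set_scope.
Local Open Scope ring_scope.
Local Open Scope quotient_scope.

Section Dual.
Context (R : realType) (X : normedModType R).

Definition continuous_linear : {pred X -> R^o} :=
  [pred f : X -> R^o | `[< linear f /\ continuous f >]].

Lemma continuous_linear_submod : submod_closed continuous_linear.
Proof.
split.
  rewrite inE; split; first by move=> a u v /=; rewrite /= scaler0 addr0.
  exact: cst_continuous.
move=> a f g; rewrite !inE => -[lf cf] [lg cg]; split.
  move=> b u v; rewrite !fctE /= lf lg !scalerDr !scalerA mulrC.
  by rewrite addrACA.
by move=> x; apply: cvgD; [apply: cvgZ; [exact: cvg_cst|exact: cf]|exact: cg].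
Qed.
HB.instance Definition _ := GRing.isSubmodClosed.Build R (X -> R^o)
  continuous_linear continuous_linear_submod.

Definition dual := {f : X -> R^o | f \in continuous_linear}.
HB.instance Definition _ := SubChoice.on dual.
HB.instance Definition _ := [SubChoice_isSubLmodule of dual by <:].

Definition dual_fun (f : dual) : X -> R := val f.
Coercion dual_fun : dual >-> Funclass.

(* `dual` is the topological dual, normed by the operator norm. *)
Definition dual_norm (f : dual) : R :=
  sup [set `|f x| | x in [set x : X | `|x| <= 1]].

Lemma dual_linear (f : dual) : linear (f : X -> R^o).
Proof. by have := valP f; rewrite inE => -[]. Qed.

Lemma dual_continuous (f : dual) : continuous (f : X -> R^o).
Proof. by have := valP f; rewrite inE => -[]. Qed.

Lemma dual0 (f : dual) : f 0 = 0.
Proof. by have := dual_linear f (-1) 0 0; rewrite scaler0 addr0 scaleN1r addNr. Qed.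

Lemma dualZ (f : dual) (a : R) x : f (a *: x) = a * f x.
Proof. by have := dual_linear f a x 0; rewrite !addr0 dual0 addr0. Qed.

Lemma dualD (f : dual) x y : f (x + y) = f x + f y.
Proof. by have := dual_linear f 1 x y; rewrite !scale1r. Qed.

Lemma dual_bounded (f : dual) : exists2 C, 0 <= C & forall x, `|f x| <= C * `|x|.
Proof.
pose L := GRing.isLinear.Build R X R^o *:%R (f : X -> R^o) (dual_linear f).
pose fl : {linear X -> R^o} := HB.pack (f : X -> R^o) L.
have /linear_bounded_continuous/linear_boundedP : continuous fl by exact: dual_continuous.
move=> /pinfty_ex_gt0 [r r0 h]; exists r; first exact: ltW.
exact: h.
Qed.

Lemma dual_has_sup (f : dual) :
  has_sup [set `|f x| | x in [set x : X | `|x| <= 1]].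
Proof.
split; first by exists `|f 0|, 0 => //=; rewrite normr0.
have [C C0 fC] := dual_bounded f; exists C => _ [x /= x1 <-].
by rewrite (le_trans (fC x))// ler_piMr.
Qed.

Lemma dual_norm_ub (f : dual) x : `|f x| <= dual_norm f * `|x|.
Proof.
have [->|x0] := eqVneq x 0; first by rewrite dual0 !normr0 mulr0.
rewrite -ler_pdivrMr ?normr_gt0//.
have -> : `|f x| / `|x| = `|f (`|x|^-1 *: x)|.
  by rewrite dualZ normrM normfV normr_id mulrC.
apply: (sup_upper_bound (dual_has_sup f)); exists (`|x|^-1 *: x) => //=.
by rewrite normrZ normfV normr_id mulVf ?normr_eq0.
Qed.

Lemma dual_norm_le (f : dual) C : 0 <= C -> (forall x, `|f x| <= C * `|x|) ->
  dual_norm f <= C.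
Proof.
move=> C0 fC; apply: sup_le_ub; first by case: (dual_has_sup f).
by move=> _ [x /= x1 <-]; rewrite (le_trans (fC x))// ler_piMr.
Qed.

Lemma dual_norm_ge0 (f : dual) : 0 <= dual_norm f.
Proof.
apply: (sup_upper_bound (dual_has_sup f)).
by exists 0; rewrite /= ?normr0 ?dual0 ?normr0.
Qed.

Lemma dual_normD (f g : dual) : dual_norm (f + g) <= dual_norm f + dual_norm g.
Proof.
apply: dual_norm_le; first by rewrite addr_ge0// dual_norm_ge0.
by move=> x; rewrite mulrDl (le_trans (ler_normD _ _))// lerD// dual_norm_ub.
Qed.

Lemma dual_normZ (a : R) (f : dual) : dual_norm (a *: f) = `|a| * dual_norm f.
Proof.
have le b (g : dual) : dual_norm (b *: g) <= `|b| * dual_norm g.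
  apply: dual_norm_le; first by rewrite mulr_ge0// dual_norm_ge0.
  move=> x; have -> : dual_fun (b *: g) x = b * g x by [].
  by rewrite normrM -mulrA ler_wpM2l// dual_norm_ub.
apply/eqP; rewrite eq_le le/=.
have [->|a0] := eqVneq a 0; first by rewrite normr0 mul0r dual_norm_ge0.
rewrite -ler_pdivlMl ?normr_gt0// -normfV.
by have := le a^-1 (a *: f); rewrite scalerA mulVf// scale1r.
Qed.

Lemma dual_funP (a : R) (f g : dual) x :
  dual_fun (a *: f + g) x = a * dual_fun f x + dual_fun g x.
Proof. by []. Qed.

Lemma dual_norm0 (f : dual) : dual_norm f = 0 -> f = 0.
Proof.
move=> f0; apply: val_inj; apply/funext => x.
by apply/eqP; rewrite -normr_le0 (le_trans (dual_norm_ub f x))// f0 mul0r.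
Qed.

HB.instance Definition _ := Lmodule_isNormed.Build R dual
  dual_normD dual_normZ dual_norm0.

Definition mk_dual (f : X -> R^o) (lf : linear f)
    (bf : exists C, forall x, `|f x| <= C * `|x|) : dual.
Proof.
exists f; rewrite inE; split => //.
pose L := GRing.isLinear.Build R X R^o *:%R f lf.
pose fl : {linear X -> R^o} := HB.pack f L.
have : bounded_near fl (nbhs 0); last by move/bounded_linear_continuous.
apply/linear_boundedP; case: bf => C fC.
apply: filterS (nbhs_pinfty_ge (num_real C)) => r Cr x.
by rewrite (le_trans (fC x))// ler_wpM2r.
Defined.

End Dual.

Section Subspace.
Context (R : realType) (X : normedModType R) (S : submodClosed X).

(* A linear subspace S, with the norm inherited from X. *)
Definition subsp := {x : X | x \in S}.
HB.instance Definition _ := SubChoice.on subsp.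
HB.instance Definition _ := [SubChoice_isSubLmodule of subsp by <:].

Let subsp_norm (x : subsp) : R := `|val x|.
Let subsp_normD x y : subsp_norm (x + y) <= subsp_norm x + subsp_norm y.
Proof. exact: ler_normD. Qed.
Let subsp_normZ (a : R) x : subsp_norm (a *: x) = `|a| * subsp_norm x.
Proof. exact: normrZ. Qed.
Let subsp_norm0 x : subsp_norm x = 0 -> x = 0.
Proof. by move=> /normr0_eq0 x0; exact: val_inj. Qed.
HB.instance Definition _ := Lmodule_isNormed.Build R subsp
  subsp_normD subsp_normZ subsp_norm0.

Lemma val_subsp_linear (a : R) (x y : subsp) :
  val (a *: x + y) = a *: val x + val y.
Proof. by []. Qed.
End Subspace.

Section Predual.
Context (R : realType).

Definition isometric_isomorphism (X Y : normedModType R) (f : X -> Y) :=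
  [/\ linear f, forall x, `|f x| = `|x| & forall y, exists x, f x = y].

Lemma bidual_embed_linear (Y : normedModType R) (y : Y) :
  linear (fun f : dual Y => f y : R^o).
Proof. by move=> a f g; exact: dual_funP. Qed.

Lemma bidual_embed_bounded (Y : normedModType R) (y : Y) :
  exists C, forall f : dual Y, `|f y| <= C * `|f|.
Proof. by exists `|y| => f; rewrite mulrC; exact: dual_norm_ub. Qed.

Definition bidual_embed (Y : normedModType R) (y : Y) : dual (dual Y) :=
  mk_dual (bidual_embed_linear y) (bidual_embed_bounded y).

Context (Y : normedModType R) (P : submodClosed (dual (dual Y))).

Lemma eval_on_linear (ys : dual Y) : linear (fun p : subsp P => dual_fun (val p) ys : R^o).
Proof. by move=> a p q; rewrite val_subsp_linear dual_funP. Qed.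

Lemma eval_on_bounded (ys : dual Y) :
  exists C, forall p : subsp P, `|dual_fun (val p) ys| <= C * `|p|.
Proof. by exists `|ys| => p; rewrite mulrC; exact: (dual_norm_ub (val p)). Qed.

(* The map Y^* -> P^* induced by the duality between Y^** and Y^*:
   eval_on ys p = p ys. *)
Definition eval_on (ys : dual Y) : dual (subsp P) :=
  mk_dual (eval_on_linear ys) (eval_on_bounded ys).

End Predual.

Definition strongly_unique_predual (R : realType) (Y : normedModType R) : Prop :=
  forall P : submodClosed (dual (dual Y)),
    closed [set p | p \in P] -> isometric_isomorphism (@eval_on R Y P) ->
    [set p | p \in P] = range (@bidual_embed R Y).

Section ClosedSpan.
Context (R : realType) (X : normedModType R).

Definition lin_span (A : set X) : set X :=
  [set x | exists n (c : 'I_n -> R) (a : 'I_n -> X),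
    (forall i, A (a i)) /\ x = \sum_(i < n) c i *: a i].

Definition closed_span (A : set X) : {pred X} :=
  [pred x | `[< closure (lin_span A) x >]].

Lemma lin_spanD (A : set X) (a : R) x y : lin_span A x -> lin_span A y -> 
  lin_span A (a *: x + y).
Proof.
move=> [n [c [f [fA ->]]]] [m [e [g [gA ->]]]].
exists (n + m)%N, (fun i => match fintype.split i with inl j => a * c j | inr j => e j end),
  (fun i => match fintype.split i with inl j => f j | inr j => g j end); split.
  by move=> i; case: fintype.split.
rewrite big_split_ord/= scaler_sumr; congr (_ + _).
  by apply: eq_bigr => i _; case: fintype.splitP => j /= ij; [rewrite scalerA; congr (_ * c _ *: f _); apply: val_inj|have := ltn_ord i; rewrite ij ltnNge leq_addr].
apply: eq_bigr => i _; case: fintype.splitP => j /= ij.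
  by have := ltn_ord j; rewrite -ij ltnNge leq_addr.
by move/addnI: ij => ij; congr (e _ *: g _); apply: val_inj.
Qed.

Lemma closed_span_submod (A : set X) : submod_closed (closed_span A).
Proof.
split.
  rewrite inE; apply: subset_closure; exists 0%N, (fun=> 0), (fun=> 0).
  by split=> [[]//|]; rewrite big_ord0.
move=> a x y; rewrite !inE => clx cly B.
move=> /nbhs_ballP[e /= e0 eB].
have a1 : 0 < `|a| + 1 by rewrite ltr_pwDr.
have [x' [Ax' xx']] := clx _ (nbhsx_ballx x (e / 2 / (`|a| + 1)) (divr_gt0 (divr_gt0 e0 (ltr0Sn _ _)) a1)).
have [y' [Ay' yy']] := cly _ (nbhsx_ballx y (e / 2) (divr_gt0 e0 (ltr0Sn _ _))).
exists (a *: x' + y'); split; first exact: lin_spanD.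
apply: eB; move: xx' yy'; rewrite -!ball_normE /= => xx' yy'.
rewrite opprD addrACA -scalerBr (le_lt_trans (ler_normD _ _))//.
rewrite [e]splitr ler_ltD// normrZ.
apply: (@le_trans _ _ ((`|a| + 1) * `|x - x'|)); first by rewrite ler_wpM2r// lerDl.
by rewrite -ler_pdivlMl// mulrC ltW.
Qed.
HB.instance Definition _ (A : set X) := GRing.isSubmodClosed.Build R X
  (closed_span A) (closed_span_submod A).

End ClosedSpan.

Section Borel.
Context (R : realType) (n : nat).

(* 'rV[R]_n carries its Borel sigma-algebra. *)
HB.instance Definition _ := @isMeasurable.Build default_measure_display
  'rV[R]_n <<s @open 'rV[R]_n >> (@sigma_algebra0 _ setT open)
  (@sigma_algebraC 'rV[R]_n open) (@sigma_algebra_bigcup _ setT open).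

Lemma open_measurable_rV (U : set 'rV[R]_n) : open U -> measurable U.
Proof. exact: sub_sigma_algebra. Qed.

Lemma measurable_rVP d (T : measurableType d) (f : T -> 'rV[R]_n) :
  (forall U, open U -> measurable (f @^-1` U)) -> measurable_fun setT f.
Proof.
move=> cf; apply: (@measurability _ _ _ _ _ _ (@open 'rV[R]_n)) => //.
by move=> _ [U oU <-]; rewrite setTI; exact: cf.
Qed.

Lemma continuous_measurable_rVR (f : 'rV[R]_n -> R) :
  continuous f -> measurable_fun setT f.
Proof.
move=> cf; apply: (measurability _ (RGenOpens.measurableE R)).
move=> _ [_ [a [b ->] <-]]; rewrite setTI; apply: open_measurable_rV.
by apply: open_comp; [move=> x _; exact: cf|exact: interval_open].
Qed.

End Borel.

Section Cons.
Context (R : realType) (n : nat).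

Definition cons_rV (p : R * 'rV[R]_n) : 'rV[R]_n.+1 :=
  row_mx (p.1%:M : 'rV[R]_1) p.2.

Definition uncons_rV (v : 'rV[R]_n.+1) : R * 'rV[R]_n :=
  (v 0 0, @rsubmx R 1 1 n v).

Lemma cons_rVK : cancel cons_rV uncons_rV.
Proof.
move=> [x v]; rewrite /uncons_rV /cons_rV/= row_mxKr; congr pair.
by rewrite mxE; case: fintype.splitP => j // _; rewrite ord1 mxE.
Qed.

Lemma ball_rVP m (x y : 'rV[R]_m) (e : R) : 0 < e ->
  ball x e y <-> forall i, `|x 0 i - y 0 i| < e.
Proof.
move=> e0; split => [[_ +] i|h]; first exact.
by split=> // i j; rewrite ord1; exact: h.
Qed.

Lemma cons_rV_ball (x y : R) (v w : 'rV[R]_n) (e : R) : 0 < e -> `|x - y| < e ->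
  ball v e w -> ball (cons_rV (x, v)) e (cons_rV (y, w)).
Proof.
move=> e0 xy /(ball_rVP _ _ e0) vw; apply/(ball_rVP _ _ e0) => i.
rewrite /cons_rV !mxE/=; case: fintype.splitP => j _ //.
by rewrite ord1 !mxE.
Qed.

Lemma rV_rat_dense (v : 'rV[R]_n) (e : R) : 0 < e ->
  exists q : 'rV[rat]_n, ball (map_mx (@ratr R) q) e v.
Proof.
move=> e0.
have ex (i : 'I_n) : exists q : rat, `|ratr q - v 0 i| < e.
  have [|q] := @rat_in_itvoo R (v 0 i - e) (v 0 i + e).
    by rewrite ltrBlDr -addrA ltrDl addr_gt0.
  by rewrite in_itv/= => h; exists q; rewrite ltr_distl.
have [q hq] := choice ex; exists (\row_i q i).
by apply/ball_rVP => // i; rewrite !mxE.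
Qed.

Lemma open_cons_measurable (U : set 'rV[R]_n.+1) :
  open U -> measurable (cons_rV @^-1` U).
Proof.
move=> oU; set P := _ @^-1` _.
pose F (t : rat * 'rV[rat]_n * nat) : set (R * 'rV[R]_n) :=
  ball (ratr t.1.1 : R) (t.2.+1%:R^-1) `*` ball (map_mx (@ratr R) t.1.2) (t.2.+1%:R^-1 : R).
pose G (k : nat) := if unpickle k is Some t then
   (if `[< F t `<=` P >] then F t else set0) else set0.
suff -> : P = \bigcup_k G k.
  apply: bigcup_measurable => k _; rewrite /G; case: unpickle => // t.
  case: ifP => // _; apply: measurableX.
    by apply: open_measurable; apply: ball_open; rewrite invr_gt0.
  by apply: open_measurable_rV; apply: ball_open; rewrite invr_gt0.
apply/seteqP; split => [[x v] Uxv|p [k _]]; last first.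
  by rewrite /G; case: unpickle => // t; case: ifPn => // /asboolP + Ft; exact.
have := oU; rewrite openE => /(_ _ Uxv); rewrite /interior => /nbhs_ballP[e /= e0 eU].
pose k := Num.truncn (2 / e).
have k0 : 0 < k.+1%:R^-1 :> R by rewrite invr_gt0.
have ke : k.+1%:R^-1 + k.+1%:R^-1 < e.
  have h : 2 / e < k.+1%:R by rewrite truncnS_gt.
  by rewrite -mulr2n -[ltLHS]mulr_natl ltr_pdivrMr// -ltr_pdivrMl// mulrC.
have [|q] := @rat_in_itvoo R (x - k.+1%:R^-1) (x + k.+1%:R^-1).
  by rewrite ltrBlDr -addrA ltrDl addr_gt0.
rewrite in_itv/= => /andP[q1 q2].
have xq : ball (ratr q : R) (k.+1%:R^-1) x by rewrite /ball/= ltr_distl q1 q2.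
have [w vw] := @rV_rat_dense v _ k0.
have FU : F (q, w, k) `<=` P.
  move=> [y z] [/= yq zw]; apply: eU; apply: cons_rV_ball => //.
  - have := ball_triangle (ball_sym xq) yq; rewrite /ball/= => /lt_trans; exact.
  - have := ball_triangle (ball_sym vw) zw.
    by move=> h; apply: (le_ball (ltW ke)).
exists (pickle (q, w, k)); first exact: I.
by rewrite /G pickleK asboolT.
Qed.

Lemma measurable_cons_rV : measurable_fun setT cons_rV.
Proof. apply: measurable_rVP; exact: open_cons_measurable. Qed.

Lemma measurable_uncons_rV : measurable_fun setT uncons_rV.
Proof.
apply: measurable_fun_pair.
  by apply: continuous_measurable_rVR; exact: coord_continuous.
apply: measurable_rVP => U oU; apply: open_measurable_rV.
apply: open_comp => // v _ A /nbhs_ballP[e /= e0 eA].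
apply/nbhs_ballP; exists e => //= w vw; apply: eA.
apply/ball_rVP => // i; rewrite !mxE.
by move/ball_rVP : vw; apply.
Qed.

Variable mu : {sigma_finite_measure set 'rV[R]_n -> \bar R}.

(* Product of the Lebesgue measure on R with mu, transported along
   R * 'rV_n ~ 'rV_n.+1. *)
Definition cons_measure : set 'rV[R]_n.+1 -> \bar R :=
  pushforward (@lebesgue_measure R \x mu)%E cons_rV.

Let cons_measure0 : cons_measure set0 = 0%E.
Proof. by rewrite /cons_measure /pushforward preimage_set0 measure0. Qed.

Let cons_measure_ge0 A : (0 <= cons_measure A)%E.
Proof. by rewrite /cons_measure /pushforward; exact: measure_ge0. Qed.

Let cons_measure_sigma_additive : semi_sigma_additive cons_measure.
Proof.
move=> F mF tF mUF; rewrite /cons_measure /pushforward preimage_bigcup.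
have mc A : measurable A -> measurable (cons_rV @^-1` A).
  by move=> mA; rewrite -[X in measurable X]setTI; exact: measurable_cons_rV.
apply: measure_semi_sigma_additive.
- by move=> k; exact: mc.
- apply/trivIsetP => /= i j _ _ ij; rewrite -preimage_setI.
  by move/trivIsetP : tF => /(_ _ _ _ _ ij) ->//; rewrite preimage_set0.
- by rewrite -preimage_bigcup; exact: mc.
Qed.

HB.instance Definition _ := isMeasure.Build _ _ _ cons_measure
  cons_measure0 cons_measure_ge0 cons_measure_sigma_additive.

Let cons_measure_sigma_finite : sigma_finite setT cons_measure.
Proof.
have /sigma_finiteP[F [FT ndF Foo]] := sigma_finiteT (@lebesgue_measure R).
have /sigma_finiteP[G [GT ndG Goo]] := sigma_finiteT mu.
exists (fun k => uncons_rV @^-1` (F k `*` G k)).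
  rewrite -preimage_bigcup; apply/seteqP; split => // v _.
  have [i _ Fi] : (\bigcup_i F i) (uncons_rV v).1 by rewrite -FT.
  have [j _ Gj] : (\bigcup_j G j) (uncons_rV v).2 by rewrite -GT.
  exists (maxn i j) => //; split.
    by move: Fi; exact/subsetPset/ndF/leq_maxl.
  by move: Gj; exact/subsetPset/ndG/leq_maxr.
move=> k; have [mF Fk] := Foo k; have [mG Gk] := Goo k; split.
  rewrite -[X in measurable X]setTI; apply: measurable_uncons_rV => //.
  exact: measurableX.
rewrite /cons_measure /pushforward -comp_preimage.
rewrite (_ : uncons_rV \o cons_rV = id); last by apply/funext; exact: cons_rVK.
by rewrite preimage_id product_measure1E// lte_mul_pinfty// ge0_fin_numE.
Qed.

HB.instance Definition _ := Measure_isSigmaFinite.Build _ _ _ cons_measure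
  cons_measure_sigma_finite.

End Cons.

Fixpoint lebesgue_rV (R : realType) (n : nat) :
    {sigma_finite_measure set 'rV[R]_n -> \bar R} :=
  if n is m.+1 then cons_measure (lebesgue_rV R m) else \d_(0 : 'rV[R]_0).

Lemma box_measurable (R : realType) n (A : 'I_n -> set R) :
  (forall i, measurable (A i)) -> measurable [set x : 'rV[R]_n | forall i, A i (x 0 i)].
Proof.
move=> mA; pose B k := if insub k is Some i then (fun x : 'rV[R]_n => x 0 i) @^-1` A i else setT.
rewrite (_ : [set _ | _] = \bigcap_k B k).
  apply: bigcapT_measurable => k; rewrite /B; case: insub => // i.
  rewrite -[X in measurable X]setTI.
  by apply: continuous_measurable_rVR => //; exact: coord_continuous.
apply/seteqP; split => [x Ax k _|x Bx i].
  by rewrite /B; case: insub => // i; exact: Ax.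
by have := Bx i I; rewrite /B valK.
Qed.

Lemma lebesgue_rV_box (R : realType) n (A : 'I_n -> set R) :
  (forall i, measurable (A i)) ->
  lebesgue_rV R n [set x : 'rV[R]_n | forall i, A i (x 0 i)] =
  (\prod_(i < n) lebesgue_measure (A i))%E.
Proof.
elim: n A => [|n IH] A mA.
  by rewrite big_ord0 /= diracE mem_set// => -[].
rewrite big_ord_recl -IH// /= /cons_measure /pushforward.
rewrite -product_measure1E//; [|exact: mA|exact: (@box_measurable R n (fun i => A (lift ord0 i)))].
congr (_ _); apply/seteqP; split => [[x v]/= h|[x v]/= [h0 h] i].
  split => [|i].
    by have := h ord0; rewrite /cons_rV mxE; case: fintype.splitP => j // _; rewrite ord1 mxE.
  have := h (lift ord0 i); rewrite /cons_rV mxE; case: fintype.splitP => j /=.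
    by rewrite /bump/= => /eqP; rewrite ord1.
  by move=> /eqP; rewrite /bump/= eqSS => /eqP ij; rewrite (_ : i = j)//; exact: val_inj.
rewrite /cons_rV mxE; case: fintype.splitP => j /= ij.
  by rewrite ord1 mxE (_ : i = ord0)//; apply: val_inj; rewrite /= ij ord1.
by rewrite (_ : i = lift ord0 j)//; apply: val_inj; rewrite /= ij.
Qed.

Section Cube.
Context (R : realType) (d : nat).
Local Notation E := 'rV[R]_d.
Local Notation mu := (lebesgue_rV R d).

Definition cube : set E := [set x | forall i, 0 <= x 0 i <= 1].

Lemma cubeE : cube = [set x : E | forall i, `[0, 1]%classic (x 0 i)].
Proof.
by apply/seteqP; split => x h i; have := h i; rewrite /= in_itv.
Qed.

Lemma cube_compact : compact cube.
Proof.
by rewrite cubeE; apply: (@rV_compact R d (fun=> `[0, 1]%classic)) => i; exact: segment_compact.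
Qed.

Lemma cube_measurable : measurable cube.
Proof.
rewrite -(setCK cube); apply: measurableC; apply: open_measurable_rV.
apply: closed_openC; apply: compact_closed; first exact: norm_hausdorff.
exact: cube_compact.
Qed.

Lemma cube_bounded (g : E -> R) : continuous g ->
  exists2 M, 0 < M & forall x, cube x -> `|g x| <= M.
Proof.
move=> cg.
have /compact_bounded[M [Mr hM]] : compact (g @` cube).
  apply: continuous_compact; last exact: cube_compact.
  by apply: continuous_subspaceT.
exists (`|M| + 1); first by rewrite ltr_pwDr.
move=> x cx; apply: (hM (`|M| + 1)); last by exists x.
by rewrite (le_lt_trans (ler_norm M))// ltrDl.
Qed.

Definition cube_integrable : {pred E -> R^o} :=
  [pred u : E -> R^o | `[< mu.-integrable cube (EFin \o u) >]].

Lemma cube_integrable_submod : submod_closed cube_integrable.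
Proof.
split; first by rewrite inE; exact: integrable0.
move=> a u v; rewrite !inE => iu iv.
have := integrableD cube_measurable (integrableZl cube_measurable a iu) iv.
by apply: eq_integrable => //; exact: cube_measurable.
Qed.
HB.instance Definition _ := GRing.isSubmodClosed.Build R (E -> R^o)
  cube_integrable cube_integrable_submod.

Definition integrable_fun := {u : E -> R^o | u \in cube_integrable}.
HB.instance Definition _ := SubChoice.on integrable_fun.
HB.instance Definition _ := [SubChoice_isSubLmodule of integrable_fun by <:].

Definition ae_null : {pred integrable_fun} :=
  [pred u | `[< {ae mu, forall x, cube x -> val u x = 0} >]].

Lemma ae_null_submod : submod_closed ae_null.
Proof.
split; first by rewrite inE; apply: aeW => x _.
move=> a u v; rewrite !inE; apply: filterS2 => x u0 v0 cx.
by rewrite /= fctE -[X in X + _]/(a * val u x) u0// v0// mulr0 addr0.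
Qed.
HB.instance Definition _ := GRing.isSubmodClosed.Build R integrable_fun
  ae_null ae_null_submod.

(* Elements of L1 are classes, modulo equality almost everywhere on the cube, of
   functions on R^d that are integrable on the cube; values outside the cube are
   irrelevant. *)
Definition L1 := Quotient.quot ae_null.
HB.instance Definition _ := GRing.Zmodule.on L1.
HB.instance Definition _ := EqQuotient.on L1.

Definition L1_scale (a : R) (u : L1) : L1 := \pi_L1 (a *: repr u).
Lemma pi_L1_eq (u v : integrable_fun) : \pi_L1 u = \pi_L1 v <-> u - v \in ae_null.
Proof. by rewrite Quotient.idealrBE; split=> [->|/eqP]. Qed.

Lemma pi_scale a u : \pi_L1 (a *: u) = L1_scale a (\pi_L1 u).
Proof.
apply/pi_L1_eq; rewrite -scalerBr rpredZ//.
by apply/pi_L1_eq; rewrite reprK.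
Qed.
Lemma pi_add u v : \pi_L1 (u + v) = \pi_L1 u + \pi_L1 v.
Proof. by rewrite !piE. Qed.

Let L1_scaleA a b u : L1_scale a (L1_scale b u) = L1_scale (a * b) u.
Proof. by elim/quotW: u => u; rewrite -(pi_scale b) -(pi_scale a) -(pi_scale (a * b)) scalerA. Qed.
Let L1_scale1 : left_id 1 L1_scale.
Proof. by move=> u; elim/quotW: u => u; rewrite -pi_scale scale1r. Qed.
Let L1_scaleDr : right_distributive L1_scale +%R.
Proof.
move=> a u v; elim/quotW: u => u; elim/quotW: v => v.
by rewrite -pi_add -(pi_scale a u) -(pi_scale a v) -(pi_scale a (u + v)) -pi_add scalerDr.
Qed.
Let L1_scaleDl u : {morph L1_scale^~ u : a b / a + b}.
Proof. elim/quotW: u => u a b.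
by rewrite -(pi_scale a) -(pi_scale b) -(pi_scale (a + b)) -pi_add scalerDl. Qed.
HB.instance Definition _ := GRing.Zmodule_isLmodule.Build R L1
  L1_scaleA L1_scale1 L1_scaleDr L1_scaleDl.

Definition L1_fun (u : L1) : E -> R := val (repr u).
Coercion L1_fun : L1 >-> Funclass.

Definition L1_norm (u : L1) : R := \int[mu]_(x in cube) `|u x|.

Lemma L1_int (u : L1) : mu.-integrable cube (EFin \o u).
Proof. by have := valP (repr u); rewrite inE. Qed.

Lemma L1_funP (a : R) (u v : L1) :
  {ae mu, forall x, cube x -> L1_fun (a *: u + v) x = a * u x + v x}.
Proof.
have : repr (a *: u + v) - (a *: repr u + repr v) \in ae_null.
  by apply/pi_L1_eq; rewrite reprK pi_add pi_scale !reprK.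
by rewrite inE; apply: filterS => x + cx => /(_ cx) /eqP; rewrite subr_eq0 => /eqP.
Qed.

Definition pairing (u : L1) (g : E -> R) : R :=
  \int[mu]_(x in cube) (u x * g x).

Lemma pairing_integrable (u : L1) (g : E -> R) : continuous g ->
  mu.-integrable cube (EFin \o (fun x => u x * g x)).
Proof.
move=> cg.
have [M M0 gM] := cube_bounded cg.
have mg : measurable_fun cube g.
  exact: measurable_funTS (continuous_measurable_rVR cg).
have bg : [bounded g x | x in cube].
  exists M; split; first exact: num_real.
  by move=> N MN x cx /=; rewrite (le_trans (gM x cx))// ltW.
have := integrableMl cube_measurable (L1_int u) mg bg.
by apply: eq_integrable => //; exact: cube_measurable.
Qed.

Lemma pairing_linear (a : R) (u v : L1) (g : E -> R) : continuous g ->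
  pairing (a *: u + v) g = a * pairing u g + pairing v g.
Proof.
move=> cg; have iu := pairing_integrable u cg; have iv := pairing_integrable v cg.
have i := pairing_integrable (a *: u + v) cg.
have iau : mu.-integrable cube (EFin \o (fun x => a * (u x * g x))).
  exact: (integrableZl cube_measurable a iu).
rewrite /pairing -RintegralZl//; last exact: cube_measurable.
rewrite -RintegralD//; last exact: cube_measurable.
congr fine; apply: ae_eq_integral.
- exact: cube_measurable.
- by case/integrableP : i.
- by case/integrableP : (integrableD cube_measurable iau iv).
- apply: filterS (L1_funP a u v) => x h cx /=.
  by rewrite h// mulrDl mulrA.
Qed.

Lemma pairingZr (a : R) (u : L1) (g : E -> R) : continuous g ->
  pairing u (fun x => a * g x) = a * pairing u g.
Proof.
move=> cg; rewrite /pairing -RintegralZl//.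
- by apply: eq_Rintegral => x _; rewrite mulrCA.
- exact: cube_measurable.
- exact: pairing_integrable.
Qed.

Lemma pairingDr (u : L1) (g h : E -> R) : continuous g -> continuous h ->
  pairing u (fun x => g x + h x) = pairing u g + pairing u h.
Proof.
move=> cg ch; rewrite /pairing -RintegralD//.
- by apply: eq_Rintegral => x _; rewrite mulrDr.
- exact: cube_measurable.
- exact: pairing_integrable.
- exact: pairing_integrable.
Qed.

Lemma L1_norm_ge0 (u : L1) : 0 <= L1_norm u.
Proof. by apply: Rintegral_ge0. Qed.

Lemma L1_norm_int (u : L1) : mu.-integrable cube (EFin \o (fun x => `|u x|)).
Proof. by have := integrable_abse (L1_int u); apply: eq_integrable => //; exact: cube_measurable. Qed.

Lemma pairing_le (u : L1) (g : E -> R) M : continuous g ->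
  (forall x, cube x -> `|g x| <= M) -> `|pairing u g| <= M * L1_norm u.
Proof.
move=> cg gM; have i := pairing_integrable u cg.
rewrite (le_trans (le_normr_Rintegral cube_measurable i))//.
rewrite /L1_norm -RintegralZl//; [|exact: cube_measurable|exact: L1_norm_int].
apply: le_Rintegral.
- exact: cube_measurable.
- by have := integrable_abse i; apply: eq_integrable => //; exact: cube_measurable.
- exact: (integrableZl cube_measurable M (L1_norm_int u)).
- by move=> x cx; rewrite normrM mulrC ler_wpM2r// gM.
Qed.

Lemma L1_norm_le (a : R) (u v : L1) :
  L1_norm (a *: u + v) <= `|a| * L1_norm u + L1_norm v.
Proof.
have iau : mu.-integrable cube (EFin \o (fun x => `|a| * `|u x|)).
  exact: (integrableZl cube_measurable `|a| (L1_norm_int u)).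
rewrite /L1_norm -RintegralZl//; [|exact: cube_measurable|exact: L1_norm_int].
rewrite -RintegralD//; [|exact: cube_measurable|exact: L1_norm_int].
have iaD : mu.-integrable cube (EFin \o (fun x => `|a * u x + v x|)).
  have := integrable_abse (integrableD cube_measurable (integrableZl cube_measurable a (L1_int u)) (L1_int v)).
  by apply: eq_integrable => //; exact: cube_measurable.
rewrite [leLHS](_ : _ = \int[mu]_(x in cube) `|a * u x + v x|).
  apply: le_Rintegral => //; first exact: cube_measurable.
    exact: (integrableD cube_measurable iau (L1_norm_int v)).
  by move=> x cx; rewrite (le_trans (ler_normD _ _))// normrM.
congr fine; apply: ae_eq_integral.
- exact: cube_measurable.
- by case/integrableP : (L1_norm_int (a *: u + v)).
- by case/integrableP : iaD.
- by apply: filterS (L1_funP a u v) => x h cx /=; rewrite h.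
Qed.

Lemma L1_norm0 (u : L1) : L1_norm u = 0 -> u = 0.
Proof.
move=> u0.
have : (\int[mu]_(x in cube) `|(EFin \o u) x| = 0)%E.
  have i := L1_norm_int u.
  have := integral_fune_fin_num cube_measurable i.
  by rewrite /= => /fineK <-; congr EFin.
have mu_ : measurable_fun cube (EFin \o u) by case/integrableP : (L1_int u).
move=> /(ae_eq_integral_abs _ cube_measurable mu_) h.
rewrite -[u]reprK -[RHS](_ : \pi_L1 0 = 0); last by rewrite piE.
apply/pi_L1_eq; rewrite subr0 inE.
by apply: filterS h => x hx cx; have [] := hx cx.
Qed.

End Cube.
Arguments cube : clear implicits.

Section TestFunctions.
Context (R : realType) (d : nat).
Local Notation E := 'rV[R]_d.
Local Notation mu := (lebesgue_rV R d).

Definition partial (i : 'I_d) (f : E -> R^o) : E -> R^o :=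
  'D_(delta_mx 0 i : E) f.

(* Ck k f: all iterated partial derivatives of order exactly k exist and are
   continuous; the lower orders come in through `smooth`. *)
Fixpoint Ck (k : nat) (f : E -> R^o) : Prop :=
  if k is k'.+1 then
    forall i : 'I_d, (forall x, derivable f x (delta_mx 0 i : E)) /\ Ck k' (partial i f)
  else continuous f.

Definition smooth (f : E -> R^o) : Prop := forall k, Ck k f.

(* C_c^oo of the open cube, each function being extended by 0 to R^d. *)
Definition test_function (f : E -> R^o) : Prop :=
  smooth f /\ let S := closure [set x | f x != 0] in
              compact S /\ S `<=` (cube R d)°.

Definition testfun := {f : E -> R^o | test_function f}.

Definition testfun_fun (f : testfun) : E -> R := sval f.
Coercion testfun_fun : testfun >-> Funclass.

Definition supnorm (f : E -> R) : \bar R :=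
  ereal_sup [set `|f x|%:E | x in cube R d].

Definition unit_ball : set testfun := [set f | (supnorm f <= 1)%E].

(* Density in the unit ball for the supremum norm. *)
Definition sup_dense (Phi : set testfun) : Prop :=
  forall f, unit_ball f -> forall e : R, 0 < e ->
    exists2 g, Phi g & (supnorm (fun x => (g x - f x)%R) < e%:E)%E.

Definition divergence (phi : 'I_d -> testfun) (x : E) : R :=
  \sum_(i < d) partial i (phi i) x.

Lemma testfun_continuous (f : testfun) : continuous f.
Proof. by case: f => f /= [/(_ 0%N)]. Qed.

Lemma partial_continuous i (f : testfun) : continuous (partial i f).
Proof. by case: f => f /= [/(_ 1%N) /(_ i) []]. Qed.

Lemma testfun_derivable i (f : testfun) x : derivable (f : E -> R^o) x (delta_mx 0 i).
Proof. by case: f => f /= [/(_ 1%N) /(_ i) []]. Qed.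

Lemma divergence_continuous phi : continuous (divergence phi).
Proof.
rewrite /divergence; elim: (index_enum _) => [|i s IH].
  rewrite (_ : (fun x => _) = (fun=> 0)); first by move=> x; apply: cst_continuous.
  by apply/funext => x; rewrite big_nil.
rewrite (_ : (fun x => _) =
    (fun x => partial i (phi i) x + \sum_(i <- s) partial i (phi i) x)).
  by move=> x; exact: (cvgD (@partial_continuous i (phi i) x) (IH x)).
by apply/funext => x; rewrite big_cons.
Qed.

Lemma Ck_ext k (f g : E -> R^o) : f = g -> Ck k f -> Ck k g.
Proof. by move=> ->. Qed.

Lemma partialZ i (a : R) (f : E -> R^o) :
  (forall x, derivable f x (delta_mx 0 i : E)) ->
  partial i (fun x => a * f x) = (fun x => a * partial i f x).
Proof.
move=> df; apply/funext => x; have := deriveZ a (df x).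
by [].
Qed.

Lemma CkZ k (a : R) (f : E -> R^o) : Ck k f -> Ck k (fun x => a * f x).
Proof.
elim: k f => [f cf|k IH f cf i] /=.
  by move=> x; exact: (cvgM (cvg_cst a) (cf x)).
have [df cdf] := cf i; split; first by move=> x; exact: derivableZ.
by rewrite (partialZ a df); exact: IH.
Qed.

Lemma test_functionZ (a : R) (f : testfun) : test_function (fun x => a * f x).
Proof.
case: f => f [sf [cS SC]]; rewrite /testfun_fun /=.
have sub : closure [set x | a * f x != 0] `<=` closure [set x | f x != 0].
  by apply: closureS => x /=; apply: contraNN => /eqP ->; rewrite mulr0.
split; first by move=> k; apply: CkZ; exact: sf.
split; last by move=> x /sub /SC.
by apply: (subclosed_compact (@closed_closure _ _) cS sub).
Qed.

Definition scale_testfun (a : R) (f : testfun) : testfun :=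
  exist _ _ (test_functionZ a f).

Lemma partial_scale i a (f : testfun) :
  partial i (scale_testfun a f) = (fun x => a * partial i f x).
Proof. by rewrite -partialZ// => x; exact: testfun_derivable. Qed.

Lemma divergence_scale a (phi : 'I_d -> testfun) :
  divergence (fun i => scale_testfun a (phi i)) = (fun x => a * divergence phi x).
Proof.
apply/funext => x; rewrite /divergence mulr_sumr.
by apply: eq_bigr => i _; rewrite partial_scale.
Qed.

Lemma supnormP (f : E -> R) (M : R) :
  (supnorm f <= M%:E)%E <-> forall x, cube R d x -> `|f x| <= M.
Proof.
split=> [h x cx|h].
  by rewrite -lee_fin; apply: le_trans h; apply: ereal_sup_ubound; exists x.
by apply: ub_ereal_sup => _ [x cx <-]; rewrite lee_fin h.
Qed.

(* The constraint max_i sup |phi_i| <= 1 is stated componentwise. *)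
Definition variation (u : L1 R d) : \bar R :=
  ereal_sup [set (pairing u (divergence phi))%:E | phi in
    [set phi : 'I_d -> testfun | forall i, (supnorm (phi i) <= 1)%E]].

Lemma variation_ub (u : L1 R d) (phi : 'I_d -> testfun) : (forall i, (supnorm (phi i) <= 1)%E) ->
  (`|pairing u (divergence phi)|%:E <= variation u)%E.
Proof.
move=> p1.
have [p0|p0] := leP 0 (pairing u (divergence phi)).
  by rewrite ger0_norm//; apply: ereal_sup_ubound; exists phi.
rewrite ltr0_norm//; apply: ereal_sup_ubound.
exists (fun i => scale_testfun (-1) (phi i)).
  move=> i; apply/supnormP => x cx /=.
  by rewrite mulN1r normrN; move/supnormP: (p1 i); apply.
rewrite divergence_scale pairingZr ?mulN1r//; exact: divergence_continuous.
Qed.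

Lemma variation_ge0 (u : L1 R d) : (0 <= variation u)%E.
Proof.
apply: ereal_sup_ubound.
have tz : test_function (fun=> 0).
  have S0 : closure [set x : E | (0 : R) != 0] = set0.
    by rewrite (_ : [set _ | _] = set0) ?closure0//; apply/seteqP; split=> x //=; rewrite eqxx.
  split; last by rewrite S0; split => //; exact: compact0.
  move=> k; elim: k => [|k IH] /=; first by move=> x; apply: cst_continuous.
  move=> i; split; first by move=> x; exact: derivable_cst.
  by apply: Ck_ext IH; apply/funext => x; rewrite /partial derive_cst.
pose z : testfun := exist _ _ tz.
exists (fun=> scale_testfun 0 z).
  by move=> i; apply/supnormP => x cx /=; rewrite mul0r normr0.
by rewrite divergence_scale pairingZr ?mul0r//; exact: divergence_continuous.
Qed.

Lemma variation_le (a : R) (u v : L1 R d) :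
  (variation (a *: u + v)%R <= `|a|%:E * variation u + variation v)%E.
Proof.
apply: ub_ereal_sup => _ [phi p1 <-].
rewrite pairing_linear; last exact: divergence_continuous.
rewrite EFinD leeD//; last by apply: ereal_sup_ubound; exists phi.
apply: (@le_trans _ _ (`|a|%:E * `|pairing u (divergence phi)|%:E)%E).
  by rewrite -EFinM lee_fin -normrM ler_norm.
by apply: lee_pmul => //; exact: variation_ub.
Qed.

Definition bounded_variation : {pred L1 R d} :=
  [pred u | (variation u < +oo)%E].

Lemma bounded_variation_submod : submod_closed bounded_variation.
Proof.
split.
  rewrite inE; apply: (@le_lt_trans _ _ 0%E); last exact: ltry.
  apply: ub_ereal_sup => _ [phi _ <-].
  have /pairing_linear := divergence_continuous (phi := phi).
  move=> /(_ (-1) 0 0); rewrite scaler0 addr0 mulN1r addNr => ->.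
  by rewrite lexx.
move=> a u v; rewrite !inE => u1 v1.
apply: (le_lt_trans (variation_le a u v)).
by rewrite lte_add_pinfty// lte_mul_pinfty// ge0_fin_numE// ?variation_ge0.
Qed.
HB.instance Definition _ := GRing.isSubmodClosed.Build R (L1 R d)
  bounded_variation bounded_variation_submod.

Definition BV := {u : L1 R d | u \in bounded_variation}.
HB.instance Definition _ := SubChoice.on BV.
HB.instance Definition _ := [SubChoice_isSubLmodule of BV by <:].

Definition BV_norm (u : BV) : R := L1_norm (val u) + fine (variation (val u)).

Lemma variation_fin_num (u : BV) : variation (val u) \is a fin_num.
Proof. by rewrite ge0_fin_numE ?variation_ge0//; exact: (valP u). Qed.

Lemma BV_norm_le (a : R) (u v : BV) :
  BV_norm (a *: u + v) <= `|a| * BV_norm u + BV_norm v.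
Proof.
rewrite /BV_norm mulrDr addrACA lerD ?L1_norm_le//.
rewrite -lee_fin EFinD EFinM !fineK ?variation_fin_num//.
exact: variation_le.
Qed.

Lemma BV_norm_ge0 u : 0 <= BV_norm u.
Proof. by rewrite addr_ge0 ?L1_norm_ge0// fine_ge0// variation_ge0. Qed.

Lemma BV_norm0 (u : BV) : BV_norm u = 0 -> u = 0.
Proof.
move=> /eqP; rewrite paddr_eq0 ?L1_norm_ge0 ?fine_ge0 ?variation_ge0//.
by move=> /andP[/eqP /L1_norm0 u0 _]; exact: val_inj.
Qed.

Lemma L1_norm00 : L1_norm (0 : L1 R d) = 0.
Proof.
have : repr (0 : L1 R d) \in @ae_null R d.
  by rewrite -[repr _]subr0; apply/pi_L1_eq; rewrite reprK piE.
rewrite inE => h.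
have m0 : measurable_fun (cube R d) (fun x => `|L1_fun (0 : L1 R d) x|%:E).
  by case/integrableP : (L1_norm_int (0 : L1 R d)).
rewrite /L1_norm /Rintegral.
rewrite (@ae_eq_integral _ _ _ _ _ (cst 0%E) _ (@cube_measurable R d) m0)//.
  by rewrite integral0.
by apply: filterS h => x h0 cx; rewrite /L1_fun h0// normr0.
Qed.

Lemma variation00 : variation (0 : L1 R d) = 0%E.
Proof.
apply/eqP; rewrite eq_le variation_ge0 andbT.
apply: ub_ereal_sup => _ [phi _ <-].
have /pairing_linear := divergence_continuous (phi := phi).
by move=> /(_ (-1) 0 0); rewrite scaler0 addr0 mulN1r addNr => ->.
Qed.

Lemma BV_norm00 : BV_norm 0 = 0.
Proof. by rewrite /BV_norm L1_norm00 variation00 addr0. Qed.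

Lemma BV_normD u v : BV_norm (u + v) <= BV_norm u + BV_norm v.
Proof. by have := BV_norm_le 1 u v; rewrite scale1r normr1 mul1r. Qed.

Lemma BV_normZ (a : R) u : BV_norm (a *: u) = `|a| * BV_norm u.
Proof.
have le b w : BV_norm (b *: w) <= `|b| * BV_norm w.
  by have := BV_norm_le b w 0; rewrite BV_norm00 !addr0.
apply/eqP; rewrite eq_le le/=.
have [->|a0] := eqVneq a 0; first by rewrite normr0 mul0r BV_norm_ge0.
rewrite -ler_pdivlMl ?normr_gt0// -normfV.
by have := le a^-1 (a *: u); rewrite scalerA mulVf// scale1r.
Qed.

HB.instance Definition _ := Lmodule_isNormed.Build R BV
  BV_normD BV_normZ BV_norm0.

Definition tuple_pairing (phi : 'I_d.+1 -> testfun) (u : BV) : R :=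
  pairing (val u) (phi ord0) +
  \sum_(i < d) pairing (val u) (partial i (phi (lift ord0 i))).

Lemma tuple_pairing_linear phi : linear (tuple_pairing phi : BV -> R^o).
Proof.
move=> a u v; rewrite /tuple_pairing.
have -> : val (a *: u + v) = a *: val u + val v by [].
rewrite pairing_linear; last exact: testfun_continuous.
under eq_bigr do rewrite (pairing_linear _ _ _ (@partial_continuous _ _)).
rewrite big_split/= -mulr_sumr addrACA; congr (_ + _).
by rewrite -mulrDr.
Qed.

Lemma pairing_partial_le i (f : testfun) :
  exists2 M, 0 <= M & forall u : BV,
    `|pairing (val u) (partial i f)| <= M * `|u|.
Proof.
have [M M0 fM] := cube_bounded (@testfun_continuous f).
exists M; first exact: ltW.
move=> u; set phi : 'I_d -> testfun :=
  fun j => if j == i then scale_testfun M^-1 f else scale_testfun 0 f.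
have p1 j : (supnorm (phi j) <= 1)%E.
  apply/supnormP => x cx; rewrite /phi; case: ifP => _ /=.
    by rewrite normrM gtr0_norm ?invr_gt0// ler_pdivrMl// mulr1 fM.
  by rewrite mul0r normr0.
have -> : pairing (val u) (partial i f) = M * pairing (val u) (divergence phi).
  rewrite -pairingZr; last exact: divergence_continuous.
  congr pairing; apply/funext => x; rewrite /divergence (bigD1 i)//= big1 ?addr0; last first.
    by move=> j ji; rewrite /phi (negbTE ji) partial_scale mul0r.
  by rewrite /phi eqxx partial_scale mulrA mulfV ?mul1r// gt_eqF.
rewrite normrM gtr0_norm// ler_wpM2l ?(ltW M0)//.
apply: (@le_trans _ _ (fine (variation (val u)))).
  rewrite -lee_fin fineK ?variation_fin_num//; exact: variation_ub.
by rewrite lerDr L1_norm_ge0.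
Qed.

Lemma tuple_pairing_bounded (phi : 'I_d.+1 -> testfun) :
  exists C, forall u : BV, `|tuple_pairing phi u : R^o| <= C * `|u|.
Proof.
have [M M0 fM] := cube_bounded (@testfun_continuous (phi ord0)).
have /choice[K hK] : forall i : 'I_d, exists K, forall u : BV,
    `|pairing (val u) (partial i (phi (lift ord0 i)))| <= K * `|u|.
  by move=> i; have [K _ hK] := pairing_partial_le i (phi (lift ord0 i)); exists K.
exists (M + \sum_(i < d) K i) => u.
rewrite mulrDl (le_trans (ler_normD _ _))// lerD//.
  rewrite (le_trans (pairing_le (val u) (@testfun_continuous (phi ord0)) fM))//.
  rewrite ler_wpM2l ?(ltW M0)//.
  by rewrite lerDl fine_ge0// variation_ge0.
rewrite mulr_suml (le_trans (ler_norm_sum _ _ _))//.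
by apply: ler_sum => i _; exact: hK.
Qed.

Definition tuple_functional (phi : 'I_d.+1 -> testfun) : dual BV :=
  mk_dual (tuple_pairing_linear phi) (tuple_pairing_bounded phi).

(* The set Phi^(d+1), seen in the dual of BV. *)
Definition tuple_functionals (Phi : set testfun) : set (dual BV) :=
  [set tuple_functional phi | phi in [set phi | forall j, Phi (phi j)]].

(* The norm closure in BV^* of the span of Phi^(d+1), with the norm of BV^*. *)
Definition W (Phi : set testfun) : normedModType R :=
  subsp (closed_span (tuple_functionals Phi)).

End TestFunctions.

(* Main.v *)
Require Import Defs.
From HB Require Import structures.
From mathcomp Require Import all_boot all_order all_algebra.
From mathcomp Require Import all_classical all_reals all_analysis.
From mathcomp Require Import measurable_realfun.
From mathcomp Require Import ring lra.
Import Order.TTheory GRing.Theory Num.Theory.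
Import numFieldNormedType.Exports.
Set Implicit Arguments.
Unset Strict Implicit.
Unset Printing Implicit Defensive.
Local Open Scope classical_set_scope.
Local Open Scope ring_scope.

(** Write Y for W(Q_0), and view elements of BV as functionals on Y by
    evaluation.  The second predual is a rank one perturbation of Y.  Given
    xi in Y^** outside the canonical copy of Y and l <> 0 in Y^* with
    1 + xi(l) <> 0, the map T f = f + xi(f) l is an automorphism of Y^*, so the
    image P of Y under its adjoint, that is P = { y + l(y) xi : y in Y }, is a
    closed subspace of Y^** on which every bounded functional is evaluation at
    a unique f in Y^*.  It differs from Y, since it contains xi up to an element
    of Y.  So P refutes strong uniqueness as soon as it is norming
    ([perturbation_not_strongly_unique]); this is where xi has to be chosen.

    Take for xi a weighted trace on the face x_i0 = 0.  Let F_n be a smooth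
    function that climbs from 0 to a fixed profile within the layer
    1/(2n) < x_i0 < 1/n, and eta_n the functional of the test function
    d_i0 F_n.  For m >= n the difference eta_m - eta_n is the functional of
    d_i0 psi with psi = F_m - F_n a test function bounded by 1 and supported in
    the strip x_i0 < 1/n.  Let xi be a weak star limit of eta_n, and l a small
    multiple of the integral over the cube.

    P is norming.  Let y in Y be the functional of a tuple of test functions,
    of norm at most 1.  Transport it by the homothety x |-> 1 + s (x - 1), with
    s < 1 close to 1: the result y_s is close to y, has norm at most s^-d, and
    is supported in x_i0 >= 1 - s.  With n large and t such that
    l(y_s - t eta_n) = t, the element of P attached to y_s - t eta_n is
    y_s + t (xi - eta_n), the limit of y_s + t (eta_m - eta_n).  The two terms
    of that sum act on disjoint regions, over which the variation of a function
    is superadditive, so the norm of the sum is at most s^-d if |t| <= 1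
    ([dilate_BV_norm_add], [dilated_layer_le]).  On f in Y^* the element takes
    the value f(y_s) + t (xi(f) - f(eta_n)), which is close to f(y).

    xi is not in Y.  Elements of Y are limits of functionals of tuples that
    vanish near the face, and these annihilate the indicator of x_i0 < t for
    small t, a function of norm at most 2; but xi takes the same positive value
    on all these indicators ([xi_not_embedded]).

    The analysis is elementary.  Differentiation under the integral sign in
    t |-> int_D f(x + t e_i) and translation invariance replace integration by
    parts ([integral_partial_le]), and the effect of homotheties on the
    Lebesgue measure is obtained by induction on the dimension
    ([lebesgue_rV_affine]). *)

(** * Perturbing a predual by an element of the bidual *)

Section Perturbation.
Context (R : realType) (Y : normedModType R).
Variables (l : dual Y) (xi : dual (dual Y)).

(** The image of [y] under the adjoint of f |-> f + xi(f) l. *)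
Definition perturbed (y : Y) : dual (dual Y) := bidual_embed y + l y *: xi.

Lemma perturbedE (y : Y) (f : dual Y) : perturbed y f = f y + l y * xi f.
Proof. by []. Qed.

(** The adjoint of f |-> f - xi(f) / (1 + xi(l)) l, the inverse of
    f |-> f + xi(f) l. *)
Definition unperturb (p : dual (dual Y)) : dual (dual Y) :=
  p - (p l / (1 + xi l)) *: xi.

Definition perturbed_predual : {pred dual (dual Y)} :=
  [pred p | `[< exists y, p = perturbed y >]].

Lemma dual_ext (X : normedModType R) (f g : dual X) :
  (forall x, f x = g x) -> f = g.
Proof. by move=> fg; apply: val_inj; apply/funext. Qed.

Lemma perturbed_linear a x y : perturbed (a *: x + y) = a *: perturbed x + perturbed y.
Proof.
apply: dual_ext => f; rewrite dual_funP !perturbedE !dualD !dualZ.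
by rewrite mulrDl mulrDr -mulrA addrACA.
Qed.

Lemma perturbed_predual_submod : submod_closed perturbed_predual.
Proof.
split.
  rewrite inE; exists 0; apply: dual_ext => f.
  by rewrite perturbedE !dual0 mul0r addr0.
move=> a p q; rewrite !inE => -[x ->] [y ->]; exists (a *: x + y).
by rewrite perturbed_linear.
Qed.
HB.instance Definition _ := GRing.isSubmodClosed.Build R (dual (dual Y))
  perturbed_predual perturbed_predual_submod.

Hypothesis xil : 1 + xi l != 0.

(** Since [unperturb] is continuous, this description transfers closedness
    from the canonical copy of [Y] to the perturbed space. *)
Lemma perturbed_predualP p :
  p \in perturbed_predual <-> range (@bidual_embed R Y) (unperturb p).
Proof.
rewrite inE /unperturb; split.
  move=> [y ->]; exists y => //; apply: dual_ext => f.
  have -> : dual_fun (perturbed y) l = l y * (1 + xi l) by rewrite perturbedE; ring.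
  rewrite mulfK// -scaleNr addrC dual_funP perturbedE -[LHS]/(dual_fun f y).
  ring.
move=> [y _ yp]; exists y; rewrite /perturbed yp.
set a := p l / _; have -> : l y = a; last by rewrite subrK.
have -> : l y = bidual_embed y l by [].
rewrite yp -scaleNr addrC dual_funP -/a.
have -> : dual_fun p l = a * (1 + xi l) by rewrite /a divfK.
ring.
Qed.

Lemma dual_eval_continuous (X : normedModType R) (f : X) :
  continuous (fun p : dual X => dual_fun p f : R^o).
Proof.
move=> p; have := @dual_continuous _ _ (bidual_embed f) p.
exact.
Qed.

Lemma unperturb_continuous : continuous unperturb.
Proof.
move=> p.
have c1 : (dual_fun q l / (1 + xi l)) @[q --> p] --> dual_fun p l / (1 + xi l).
  exact: (cvgM (@dual_eval_continuous _ l p) (cvg_cst _)).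
exact: (cvgB (@cvg_id _ (nbhs p)) (@cvgZr_tmp _ _ _ _ _ _ _ xi c1)).
Qed.

Lemma perturbed_predual_closed : closed (range (@bidual_embed R Y)) ->
  closed [set p | p \in perturbed_predual].
Proof.
move=> cY; rewrite (_ : [set _ | _] = unperturb @^-1` range (@bidual_embed R Y)).
  by apply: closed_comp => // p _; exact: unperturb_continuous.
by apply/seteqP; split => p /perturbed_predualP.
Qed.

Lemma perturbed_in y : perturbed y \in perturbed_predual.
Proof. by rewrite inE; exists y. Qed.

Definition perturbed_elt y : subsp perturbed_predual :=
  exist (fun p => p \in perturbed_predual) _ (perturbed_in y).

Lemma bidual_embed_le (y : Y) : `|bidual_embed y| <= `|y|.
Proof. by apply: dual_norm_le => // f; rewrite mulrC; exact: (dual_norm_ub f y). Qed.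

Lemma perturbed_le y : `|perturbed y| <= (1 + `|l| * `|xi|) * `|y|.
Proof.
rewrite mulrDl mul1r (le_trans (ler_normD _ _))// lerD ?bidual_embed_le//.
by rewrite normrZ mulrAC ler_wpM2r//; exact: dual_norm_ub.
Qed.

(** A functional [g] on the perturbed space pulls back to the element
    y |-> g (perturbed y) of the dual of [Y], and [g] is evaluation at the
    preimage of that element under f |-> f + xi(f) l. *)
Lemma eval_on_perturbed_onto (g : dual (subsp perturbed_predual)) :
  exists f : dual Y, eval_on perturbed_predual f = g.
Proof.
have hl : linear (fun y => dual_fun g (perturbed_elt y) : R^o).
  move=> a x y; rewrite -[RHS]/(a * _ + _) -dualZ -dualD; congr (dual_fun g _).
  by apply: val_inj; rewrite val_subsp_linear; exact: perturbed_linear.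
have hb : exists C, forall y, `|dual_fun g (perturbed_elt y) : R^o| <= C * `|y|.
  exists (`|g| * (1 + `|l| * `|xi|)) => y; rewrite (le_trans (dual_norm_ub _ _))//.
  by rewrite -mulrA ler_wpM2l ?dual_norm_ge0//; exact: (perturbed_le y).
pose h : dual Y := mk_dual hl hb.
exists (- (xi h / (1 + xi l)) *: l + h); apply: dual_ext => -[p pP].
have [y yp] : exists y, p = perturbed y by move: pP; rewrite inE.
have -> : exist _ p pP = perturbed_elt y by exact: val_inj.
rewrite -[LHS]/(dual_fun (perturbed y) _) perturbedE dualD dualZ dual_funP.
rewrite -[in RHS]/(dual_fun h y).
rewrite [X in _ = X](_ : _ = h y)//.
set a := xi h / _; have -> : dual_fun xi h = a * (1 + xi l) by rewrite /a divfK.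
ring.
Qed.

(** The perturbed space contains l(y) xi up to an element of [Y], hence cannot
    be the canonical copy; all that separates it from being an isometric
    predual is that it be norming. *)
Lemma perturbation_not_strongly_unique :
  closed (range (@bidual_embed R Y)) -> ~ range (@bidual_embed R Y) xi ->
  l != 0 ->
  (forall (f : dual Y) N, 0 <= N ->
    (forall y, `|perturbed y f| <= N * `|perturbed y|) -> `|f| <= N) ->
  ~ strongly_unique_predual Y.
Proof.
move=> cY xiY l0 norming /(_ perturbed_predual (perturbed_predual_closed cY)) H.
have {H} PY : [set p | p \in perturbed_predual] = range (@bidual_embed R Y).
  apply: H; split; last exact: eval_on_perturbed_onto.
    by move=> a f g; apply: dual_ext => p; rewrite dual_funP -[LHS]/(dual_fun (val p) _) dualD dualZ.
  move=> f; apply/eqP; rewrite eq_le; apply/andP; split.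
    by apply: dual_norm_le => // p; rewrite mulrC; exact: (dual_norm_ub (val p)).
  by apply: norming => // y; exact: (dual_norm_ub (eval_on perturbed_predual f) (perturbed_elt y)).
have [y ly] : exists y, l y != 0.
  apply/not_existsP => h; move/eqP: l0; apply; apply: dual_ext => y.
  by apply/eqP; have /negP := h y; rewrite negbK.
have [z _ zy] : range (@bidual_embed R Y) (perturbed y).
  by rewrite -PY; exact: perturbed_in.
apply: xiY; exists ((l y)^-1 *: (z - y)) => //; apply: dual_ext => f.
have := congr1 (fun p => dual_fun p f) zy; rewrite perturbedE => e.
rewrite -[LHS]/(dual_fun f _) dualZ dualD -scaleN1r dualZ -[dual_fun f z]/(bidual_embed z f) e.
by field.
Qed.
End Perturbation.

(** * Lebesgue measure under translations and homotheties *)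

Section AffineMeasure.
Context (R : realType).

Definition affine_map (V : lmodType R) (a : V) (s : R) (x : V) : V := a + s *: x.

Lemma affine_map_continuous (V : normedModType R) (a : V) s :
  continuous (affine_map a s).
Proof. by move=> x; apply: cvgD; [exact: cvg_cst|apply: cvgZl_tmp; exact: cvg_id]. Qed.

Lemma measurable_affine_R (a s : R) : measurable_fun setT (affine_map (a : R^o) s : R -> R).
Proof. by apply: continuous_measurable_fun; exact: affine_map_continuous. Qed.

Lemma measurable_affine_rV n (a : 'rV[R]_n) (s : R) :
  measurable_fun setT (affine_map a s).
Proof.
apply: measurable_rVP => U oU; apply: open_measurable_rV.
by apply: open_comp => // x _; exact: affine_map_continuous.
Qed.

Lemma affine_preimage_itv (a s x y : R) : 0 < s ->
  affine_map (a : R^o) s @^-1` `]x, y] = `](x - a) / s, (y - a) / s]%classic.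
Proof.
move=> s0; apply/seteqP; split => t /=; rewrite !in_itv/= /affine_map;
by rewrite ltr_pdivrMr// ler_pdivlMr// ltrBlDl lerBrDl mulrC.
Qed.

(** Lebesgue measure is characterized by its values on half-open intervals. *)
Lemma lebesgue_measure_affine (a s : R) (A : set R) : 0 < s -> measurable A ->
  lebesgue_measure (affine_map (a : R^o) s @^-1` A) = ((s^-1)%:E * lebesgue_measure A)%E.
Proof.
move=> s0 mA.
have mf := measurable_affine_R a s.
pose k : {nonneg R} := NngNum (ltW s0).
suff -> : lebesgue_measure A =
    mscale k (pushforward (@lebesgue_measure R)
      (affine_map (a : R^o) s : measurableTypeR R -> measurableTypeR R)) A.
  rewrite /mscale/= /pushforward muleA -EFinM mulVf ?mul1e// gt_eqF//.
move=> m; apply: lebesgue_measure_unique => // _ [[x y] _ <-] /=.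
rewrite /mscale/= /pushforward.
rewrite affine_preimage_itv// !lebesgue_measure_itv/= !lte_fin.
rewrite ltr_pM2r ?invr_gt0// ltrD2r; case: ifP; rewrite ?mule0// => _.
rewrite -!EFinD -EFinM; congr EFin; field; lra.
Qed.

(** By induction on the dimension: after splitting off the first coordinate
    the map acts on each factor, and a product measure is determined by
    rectangles. *)
Lemma lebesgue_rV_affine n (a : 'rV[R]_n) (s : R) (A : set 'rV[R]_n) :
  0 < s -> measurable A ->
  lebesgue_rV R n (affine_map a s @^-1` A) = ((s^-1 ^+ n)%:E * lebesgue_rV R n A)%E.
Proof.
move=> s0; elim: n a A => [a A mA|n IH a A mA].
  rewrite expr0 mul1e; congr (lebesgue_rV _ _ _).
  apply/seteqP; split => v; rewrite /preimage/= => h.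
    by rewrite (_ : v = affine_map a s v)//; apply/rowP => -[].
  by rewrite (_ : affine_map a s v = v)//; apply/rowP => -[].
pose a0 : R := a 0 0; pose a' : 'rV[R]_n := @rsubmx R 1 1 n a.
pose g (p : R * 'rV[R]_n) : R * 'rV[R]_n := (affine_map (a0 : R^o) s p.1, affine_map a' s p.2).
have mg : measurable_fun setT g.
  apply: measurable_fun_pair.
    by apply: measurableT_comp; [exact: measurable_affine_R|exact: measurable_fst].
  by apply: measurableT_comp; [exact: measurable_affine_rV|exact: measurable_snd].
have cg t v : cons_rV (g (t, v)) = affine_map a s (cons_rV (t, v)).
  apply/rowP => j; rewrite /cons_rV /affine_map !mxE.
  case: fintype.splitP => i ij; rewrite !mxE.
    rewrite ord1 eqxx !mulr1n /a0 /=. congr (a _ _ + _).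
    by apply: val_inj; rewrite /= ij ord1.
  congr (a _ _ + _).
  by apply: val_inj; rewrite /= ij.
have gA : cons_rV (n:=n) @^-1` (affine_map a s @^-1` A) = g @^-1` (cons_rV (n:=n) @^-1` A).
  by apply/seteqP; split => -[t v]; rewrite /preimage/= cg.
have sn0 : 0 <= s ^+ n.+1 by rewrite exprn_ge0// ltW.
rewrite /= /cons_measure /pushforward gA.
set X := _ @^-1` A; have mX : measurable X.
  by rewrite -[X]setTI; apply: measurable_cons_rV.
suff -> : (lebesgue_measure \x lebesgue_rV R n)%E X =
    mscale (NngNum sn0) (pushforward (lebesgue_measure \x lebesgue_rV R n)%E
      (g : measurableTypeR R * 'rV[R]_n -> measurableTypeR R * 'rV[R]_n)) X.
  by rewrite /mscale/= /pushforward muleA -EFinM -exprMn mulVf ?expr1n ?mul1e// gt_eqF.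
move=> m; apply: product_measure_unique => // C D mC mD.
rewrite -[LHS]/((s ^+ n.+1)%:E * (lebesgue_measure \x lebesgue_rV R n)
  ((affine_map (a0 : R^o) s @^-1` C) `*` (affine_map a' s @^-1` D)))%E.
rewrite product_measure1E//; last 2 first.
- by rewrite -[X in measurable X]setTI; apply: measurable_affine_R.
- by rewrite -[X in measurable X]setTI; apply: measurable_affine_rV.
transitivity ((s ^+ n.+1)%:E * (((s^-1)%:E * lebesgue_measure C) *
    ((s^-1 ^+ n)%:E * lebesgue_rV R n D)))%E.
  by congr (_ * (_ * _))%E; [exact: lebesgue_measure_affine|exact: IH].
rewrite (muleACA (s^-1)%:E) -(EFinM s^-1) (muleA (s ^+ n.+1)%:E) -EFinM -exprS.
by rewrite exprVn mulfV ?mul1e// expf_neq0// gt_eqF.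
Qed.

Section AffineIntegral.
Context (n : nat) (a : 'rV[R]_n) (s : R) (s0 : 0 < s).
Local Notation mu := (lebesgue_rV R n).
Local Notation T := (affine_map a s).
Variable D : set 'rV[R]_n.
Hypothesis mD : measurable D.
Local Open Scope ereal_scope.

Lemma measurable_affine_preimage : measurable (T @^-1` D).
Proof. by rewrite -[X in measurable X]setTI; apply: measurable_affine_rV. Qed.

Lemma ge0_integral_affine (f : 'rV[R]_n -> \bar R) :
  measurable_fun D f -> (forall x, D x -> 0 <= f x) ->
  \int[mu]_(x in T @^-1` D) f (T x) = (s^-1 ^+ n)%:E * \int[mu]_(x in D) f x.
Proof.
move=> mf f0.
have sn0 : (0 <= s^-1 ^+ n)%R by rewrite exprn_ge0// invr_ge0 ltW.
have mT := measurable_affine_rV a s.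
rewrite -[RHS](@ge0_integral_mscale _ _ _ mu D mD (NngNum sn0))//.
rewrite -[LHS](@ge0_integral_pushforward _ _ _ _ _ _ mT)//; last first.
  by move=> x /set_mem; exact: f0.
apply: eq_measure_integral => A mA _; rewrite /mscale/= /pushforward.
exact: lebesgue_rV_affine.
Qed.

Lemma integrable_affine (f : 'rV[R]_n -> \bar R) : mu.-integrable D f ->
  mu.-integrable (T @^-1` D) (f \o T).
Proof.
move=> /integrableP[mf foo]; apply/integrableP; split.
  apply: (@measurable_comp _ _ _ _ _ _ D) => //.
    by move=> _ [x ? <-].
  by apply: measurable_funTS; exact: measurable_affine_rV.
rewrite (ge0_integral_affine (f := fun x => `|f x|)) => //; last exact: measurableT_comp.
by rewrite lte_mul_pinfty// lee_fin exprn_ge0// invr_ge0 ltW.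
Qed.

Lemma integral_affine (f : 'rV[R]_n -> \bar R) : mu.-integrable D f ->
  \int[mu]_(x in T @^-1` D) f (T x) = (s^-1 ^+ n)%:E * \int[mu]_(x in D) f x.
Proof.
move=> fi; have mf : measurable_fun D f by case/integrableP : fi.
rewrite integralE [in RHS]integralE.
rewrite muleBr//; last first.
  by apply: fin_num_adde_defl; rewrite fin_numN; exact: integrable_neg_fin_num.
congr (_ - _).
  rewrite -(ge0_integral_affine (f := f^\+))//.
    by rewrite (funepos_comp f T).
  exact: measurable_funepos.
rewrite -(ge0_integral_affine (f := f^\-))//.
  by rewrite (funeneg_comp f T).
exact: measurable_funeneg.
Qed.

Lemma Rintegral_affine (f : 'rV[R]_n -> R) : mu.-integrable D (EFin \o f) ->
  (\int[mu]_(x in T @^-1` D) f (T x) = s^-1 ^+ n * \int[mu]_(x in D) f x)%R.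
Proof.
move=> fi; rewrite /Rintegral (integral_affine fi) fineM//.
exact: integral_fune_fin_num.
Qed.
End AffineIntegral.
End AffineMeasure.

(** * A calculus of smooth functions *)

Section FlatFunction.
Context (R : realType).

(** Up to the powers of 1/x, the function exp(-1/x) extended by 0.  The
    derivatives of each member are combinations of members, which is what
    makes exp(-1/x) smooth. *)
Definition flat (n : nat) (x : R) : R :=
  if 0 < x then x^-1 ^+ n * expR (- x^-1) else 0.

Lemma flat_ge0 n x : 0 <= flat n x.
Proof. by rewrite /flat; case: ifP => // x0; rewrite mulr_ge0 ?expR_ge0// exprn_ge0// invr_ge0 ltW. Qed.

(** The Taylor bound exp(1/x) >= x^-(n+1) / (n+1)! absorbs the pole. *)
Lemma flat_le n (x : R) : flat n x <= n.+1`!%:R * `|x|.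
Proof.
rewrite /flat; case: ifPn => [x0|_]; last by rewrite mulr_ge0.
rewrite gtr0_norm// expRN ler_pdivrMr ?expR_gt0//.
have x1 : 0 <= x^-1 by rewrite invr_ge0 ltW.
have h : x^-1 ^+ n.+1 / n.+1`!%:R <= expR x^-1.
  by apply: le_trans (expR_ge1Dxn n x1); rewrite lerDr.
rewrite -mulrA -ler_pdivrMl ?ltr0n ?fact_gt0//.
apply: le_trans (ler_wpM2l (ltW x0) h).
by rewrite exprS mulrA mulrA mulfV ?gt_eqF// mul1r mulrC.
Qed.

Lemma flat0_le1 x : flat 0 x <= 1.
Proof.
rewrite /flat; case: ifP => // x0.
by rewrite expr0 mul1r expR_le1 oppr_le0 invr_ge0 ltW.
Qed.

Lemma flat_neg n x : x <= 0 -> flat n x = 0.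
Proof. by rewrite /flat leNgt => /negbTE ->. Qed.

Definition flat' n x : R := flat n.+2 x - n%:R * flat n.+1 x.

Lemma is_derive_flat n (x : R) : is_derive x 1 (flat n : R -> R^o) (flat' n x).
Proof.
have [x0|x0|->] := ltrgtP x 0.
- apply: (@near_eq_is_derive _ _ _ (cst 0)).
    near=> y; rewrite flat_neg//; apply/ltW.
    near: y; exact: lt_nbhsl.
  rewrite /flat' !flat_neg ?ltW// mulr0 subrr; exact: is_derive_cst.
- pose g (y : R) : R := y^-1.
  have xn0 : x != 0 by rewrite gt_eqF.
  have dg : is_derive x 1 g (- x ^- 2).
    apply: DeriveDef; first exact: (@derivableV R R id).
    by rewrite (@deriveV R R id)// derive_id [LHS]mulr1.
  have dF : is_derive x 1 ((g ^+ n : R -> R) * (expR \o (- g)) : R -> R) (flat' n x).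
    apply: is_derive_eq.
    have -> : (g ^+ n) x = x^-1 ^+ n by rewrite fctE.
    rewrite -[LHS]/(x^-1 ^+ n * (expR (- x^-1) * - - x ^- 2) +
      expR (- x^-1) * (n%:R * x^-1 ^+ n.-1 * - x ^- 2)).
    rewrite /flat' /flat x0 opprK -!exprVn.
    case: n => [|n]; first by rewrite !mul0r mulr0 !subr0 addr0 !expr0 mul1r mulrC.
    by rewrite /= !exprS expr0 mulr1; ring.
  apply: near_eq_is_derive dF.
  near=> y; have y0 : 0 < y by near: y; exact: lt_nbhsr.
  by rewrite /flat y0 -[LHS]/((g ^+ n) y * expR (- y^-1)) fctE.
(* At 0 the difference quotient of [flat n] is [flat n.+1]. *)
- have q : (fun h : R => h^-1 *: (((flat n : R -> R^o) \o shift 0) (h *: 1) - flat n 0)) = flat n.+1.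
    apply/funext => h /=; rewrite addr0 (@flat_neg n 0)// subr0 /flat.
    rewrite [h *: 1]mulr1 [LHS]mulrC; case: ifP => h0; last by rewrite mul0r.
    by rewrite exprS mulrC mulrA.
  have c : flat n.+1 x @[x --> 0^'] --> flat' n 0.
    rewrite /flat' !flat_neg// mulr0 subrr.
    apply: cvg_within_filter.
    apply: (@squeeze_cvgr _ _ _ _ (cst 0) (fun x : R => n.+2`!%:R * `|x|)).
    - by near=> y; rewrite flat_ge0 flat_le.
    - exact: cvg_cst.
    - rewrite -[X in _ --> X](mulr0 (n.+2`!%:R : R)) -[in X in _ --> X](@normr0 _ R).
      apply: cvgM; first exact: cvg_cst.
      exact: (@norm_continuous _ R).
  apply: DeriveDef; rewrite /derivable ?/derive q; last exact: cvg_lim.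
  by apply/cvg_ex; eexists; exact: c.
Unshelve. all: by end_near.
Qed.
End FlatFunction.

Section Smooth.
Context (R : realType) (d : nat).
Local Notation E := 'rV[R]_d.
Local Notation e_ i := (delta_mx 0 i : E).
Implicit Types (f g : E -> R^o) (i : 'I_d).

(** Directional derivatives are derivatives along lines, so the rules of one
    variable apply to them. *)
Lemma line_quotient f (v x : E) (t : R) :
  (fun h : R => h^-1 *: (((fun r : R => f (x + r *: v)) \o shift t) (h *: 1) - f (x + t *: v)))
   = (fun h : R => h^-1 *: ((f \o shift (x + t *: v)) (h *: v) - f (x + t *: v))).
Proof.
apply/funext => h /=; rewrite [h *: 1]mulr1; congr (_ *: (f _ - _)).
by rewrite scalerDl addrCA.
Qed.

Lemma is_derive_line f (v x : E) (t df : R) :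
  is_derive (x + t *: v) v f df ->
  is_derive t 1 ((fun r : R => f (x + r *: v)) : R -> R^o) df.
Proof.
by move=> [df1 <-]; apply: DeriveDef; rewrite /derivable ?/derive line_quotient.
Qed.

Lemma is_derive_of_line f (v x : E) (t df : R) :
  is_derive t 1 ((fun r : R => f (x + r *: v)) : R -> R^o) df ->
  is_derive (x + t *: v) v f df.
Proof.
move=> [df1 <-]; apply: DeriveDef; first by rewrite /derivable -line_quotient.
by rewrite /derive -line_quotient.
Qed.

Lemma is_derive_comp_line (phi : R -> R) f (v x : E) (dphi df : R) :
  is_derive (f x) 1 (phi : R -> R^o) dphi -> is_derive x v f df ->
  is_derive x v ((fun y => phi (f y)) : E -> R^o) (dphi * df).
Proof.
move=> hp hf.
have -> : x = x + 0 *: v by rewrite scale0r addr0.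
apply: is_derive_of_line.
have hf' : is_derive (0 : R) 1 (fun r : R => f (x + r *: v)) df.
  by apply: is_derive_line; rewrite scale0r addr0.
have hp' : is_derive ((fun r : R => f (x + r *: v)) 0) 1 phi dphi.
  by rewrite scale0r addr0.
exact: (is_derive1_comp hp' hf').
Qed.

Lemma smooth_derivable f i x : smooth f -> derivable f x (e_ i).
Proof. by move=> /(_ 1%N) /(_ i) []. Qed.

Lemma smooth_partial f i : smooth f -> smooth (partial i f).
Proof. by move=> sf k; have /(_ i) [] := sf k.+1. Qed.

Lemma smooth_continuous f : smooth f -> continuous f.
Proof. by move=> /(_ 0%N). Qed.

Lemma smooth_is_derive f i x : smooth f -> is_derive x (e_ i) f (partial i f x).
Proof. by move=> /(@smooth_derivable _ i x) h; apply: DeriveDef. Qed.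

Lemma is_derive_partial f i (df : E -> R) :
  (forall x, is_derive x (e_ i) f (df x)) -> partial i f = df.
Proof. by move=> h; apply/funext => x; rewrite /partial; have [_ ->] := h x. Qed.

Lemma CkD k f g : Ck k f -> Ck k g -> Ck k (fun x => f x + g x).
Proof.
elim: k f g => [f g cf cg x|k IH f g cf cg i]; first exact: (cvgD (cf x) (cg x)).
have [df cdf] := cf i; have [dg cdg] := cg i.
split; first by move=> x; exact: (derivableD (df x) (dg x)).
rewrite (_ : partial i _ = (fun x => partial i f x + partial i g x)); first exact: IH.
by apply/funext => x; exact: (deriveD (df x) (dg x)).
Qed.

(** [Ck k] only speaks of the derivatives of order [k], whereas the Leibniz
    rule also produces those of lower order. *)
Lemma CkM k f g : (forall j, (j <= k)%N -> Ck j f) -> (forall j, (j <= k)%N -> Ck j g) ->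
  Ck k (fun x => f x * g x).
Proof.
elim: k f g => [f g cf cg x|k IH f g cf cg i].
  exact: (cvgM (cf _ (leqnn _) x) (cg _ (leqnn _) x)).
have [df _] := cf _ (leqnn _) i; have [dg _] := cg _ (leqnn _) i.
split; first by move=> x; exact: (derivableM (df x) (dg x)).
rewrite (_ : partial i _ = (fun x => f x * partial i g x + g x * partial i f x)); last first.
  by apply/funext => x; exact: (deriveM (df x) (dg x)).
apply: CkD; apply: IH => j jk.
- by apply: cf; exact: leq_trans jk _.
- by have /(_ i) [] := cg j.+1 jk.
- by apply: cg; exact: leq_trans jk _.
- by have /(_ i) [] := cf j.+1 jk.
Qed.

Lemma smoothD f g : smooth f -> smooth g -> smooth (fun x => f x + g x).
Proof. by move=> sf sg k; exact: CkD. Qed.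

Lemma smoothM f g : smooth f -> smooth g -> smooth (fun x => f x * g x).
Proof. by move=> sf sg k; apply: CkM => j _. Qed.

Lemma smoothZ a f : smooth f -> smooth (fun x => a * f x).
Proof. by move=> sf k; apply: CkZ. Qed.

Lemma smooth_cst (a : R) : smooth ((fun=> a) : E -> R^o).
Proof.
move=> k; elim: k a => [|k IH] a; first by move=> x; exact: cst_continuous.
move=> i; split; first by move=> x; exact: derivable_cst.
by apply: Ck_ext (IH 0); apply/funext => x; rewrite /partial derive_cst.
Qed.

Lemma is_derive_coord j i (x : E) :
  is_derive x (e_ i) ((fun y : E => y 0 j) : E -> R^o) (i == j)%:R.
Proof.
have -> : x = x + 0 *: e_ i by rewrite scale0r addr0.
apply: is_derive_of_line.
have -> : (fun r : R => (x + r *: e_ i) 0 j) = (fun r : R => x 0 j + (i == j)%:R * r).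
  by apply/funext => r; rewrite !mxE eqxx/= mulrC eq_sym.
have := @is_deriveD R R R (cst (x 0 j)) ((i == j)%:R \*: id) 0 1 _ _ _ _.
by move=> h; apply: is_derive_eq; rewrite add0r [LHS]mulr1.
Qed.

Lemma smooth_coord j : smooth ((fun y : E => y 0 j) : E -> R^o).
Proof.
case=> [|k i]; first by exact: coord_continuous.
split; first by move=> x; have [] := is_derive_coord j i x.
rewrite (is_derive_partial (is_derive_coord j i)); exact: smooth_cst.
Qed.

Lemma is_derive_affine_comp f i (a : E) (s : R) x : smooth f ->
  is_derive x (e_ i) ((fun y => f (a + s *: y)) : E -> R^o) (s * partial i f (a + s *: x)).
Proof.
move=> sf.
have -> : x = x + 0 *: e_ i by rewrite scale0r addr0.
apply: is_derive_of_line.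
have -> : (fun r : R => f (a + s *: (x + r *: e_ i))) =
    (fun r : R => f (a + s *: x + r *: e_ i)) \o (fun r => s * r).
  by apply/funext => r /=; rewrite scalerDr addrA scalerA.
rewrite [s * _]mulrC scale0r addr0; apply: (@is_derive1_comp _ _ (fun r => s * r)).
  by apply: is_derive_line; rewrite mulr0 scale0r addr0; exact: smooth_is_derive.
have h : is_derive (0 : R) 1 (s \*: (id : R -> R^o)) (s *: 1) by exact: is_deriveZ.
by apply: is_derive_eq h _; exact: mulr1.
Qed.

Lemma partial_affine_comp f i (a : E) (s : R) : smooth f ->
  partial i (fun y => f (a + s *: y)) = (fun x => s * partial i f (a + s *: x)).
Proof. by move=> sf; apply: is_derive_partial => x; exact: is_derive_affine_comp. Qed.

Lemma smooth_affine_comp f (a : E) (s : R) : smooth f -> smooth (fun y => f (a + s *: y)).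
Proof.
move=> sf k; elim: k f sf => [|k IH] f sf.
  move=> x; apply: (@continuous_comp _ _ _ (fun y : E => a + s *: y) f).
    exact: (@affine_map_continuous _ _ a s).
  exact: smooth_continuous.
move=> i; split; first by move=> x; have [] := is_derive_affine_comp i a s x sf.
by rewrite partial_affine_comp//; apply: CkZ; apply: IH; exact: smooth_partial.
Qed.

Lemma is_derive_flat_comp n f i x : smooth f ->
  is_derive x (e_ i) ((fun y => flat n (f y)) : E -> R^o) (flat' n (f x) * partial i f x).
Proof.
by move=> sf; apply: is_derive_comp_line; [exact: is_derive_flat|exact: smooth_is_derive].
Qed.

(** The induction runs over all members of the family [flat] at once, because
    differentiation moves from one member to the next ones. *)
Lemma smooth_flat_comp n f : smooth f -> smooth (fun y => flat n (f y)).
Proof.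
move=> sf k; elim/ltn_ind: k n => -[_|k IH] n.
  move=> x; apply: (@continuous_comp _ _ _ f (flat n)); first exact: smooth_continuous.
  apply: differentiable_continuous; apply/derivable1_diffP.
  by have [] := is_derive_flat n (f x).
move=> i; split; first by move=> x; have [] := is_derive_flat_comp n i x sf.
rewrite (is_derive_partial (fun x => is_derive_flat_comp n i x sf)).
apply: CkM => j jk; last exact: smooth_partial.
rewrite /flat'.
have -> : (fun x => flat n.+2 (f x) - n%:R * flat n.+1 (f x)) =
  (fun x => flat n.+2 (f x) + (- n%:R) * flat n.+1 (f x)).
  by apply/funext => x; rewrite mulNr.
by apply: CkD; [exact: IH|apply: CkZ; exact: IH].
Qed.
End Smooth.

(** * Test functions and the integrals of their derivatives *)

Section TestCalculus.
Context (R : realType) (d : nat).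
Local Notation E := 'rV[R]_d.
Local Notation mu := (lebesgue_rV R d).
Local Notation e_ i := (delta_mx 0 i : E).
Implicit Types (i : 'I_d).

Lemma test_function_sub (h : E -> R^o) (K : set E) : smooth h -> compact K ->
  K `<=` (cube R d)° -> (forall x, h x != 0 -> K x) -> test_function h.
Proof.
move=> sh cK KC hK; have sub : closure [set x | h x != 0] `<=` K.
  rewrite [X in _ `<=` X](closure_id _).1; first exact: closureS.
  by apply: compact_closed => //; exact: norm_hausdorff.
split=> //; split; last exact: subset_trans KC.
exact: (subclosed_compact (@closed_closure _ _) cK sub).
Qed.

Definition support (f : E -> R^o) : set E := closure [set x | f x != 0].

Lemma testfun_smooth (f : testfun R d) : smooth (f : E -> R^o).
Proof. by have [] := svalP f. Qed.

Lemma testfun_supportK (f : testfun R d) : compact (support f).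
Proof. by have [_ []] := svalP f. Qed.

Lemma testfun_support_cube (f : testfun R d) : support f `<=` (cube R d)°.
Proof. by have [_ []] := svalP f. Qed.

Lemma supportP (f : E -> R^o) x : f x != 0 -> support f x.
Proof. by move=> fx; apply: subset_closure. Qed.

Lemma testfun_out (f : testfun R d) x : ~ cube R d x -> f x = 0.
Proof.
move=> nx; apply/eqP/negP => /negP fx; apply: nx.
by apply: interior_subset; apply: (@testfun_support_cube f); exact: supportP.
Qed.

Lemma partial_support (f : E -> R^o) i x : partial i f x != 0 -> support f x.
Proof.
apply: contra_neqP => nx; rewrite /partial.
rewrite (@near_eq_derive _ _ _ f (cst 0)) ?derive_cst//.
have : nbhs x (~` support f).
  by apply: open_nbhs_nbhs; split => //; exact/closed_openC/closed_closure.
apply: filterS => y ny /=; apply/eqP; apply: contra_notT ny; exact: supportP.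
Qed.

Lemma test_function_partial (f : testfun R d) i : test_function (partial i f).
Proof.
apply: (test_function_sub _ (@testfun_supportK f) (@testfun_support_cube f)).
  by apply: smooth_partial; exact: testfun_smooth.
exact: partial_support.
Qed.

Definition partial_testfun i (f : testfun R d) : testfun R d :=
  exist _ _ (test_function_partial f i).

Lemma test_functionD (f g : testfun R d) : test_function (fun x => f x + g x).
Proof.
apply: (@test_function_sub _ (support f `|` support g)).
- by apply: smoothD; exact: testfun_smooth.
- by apply: compactU; exact: testfun_supportK.
- by rewrite subUset; split; exact: testfun_support_cube.
- move=> x; have [fx|fx _] := eqVneq (f x) 0; last by left; exact: supportP.
  by rewrite fx add0r => gx; right; exact: supportP.
Qed.

Definition add_testfun (f g : testfun R d) : testfun R d := exist _ _ (test_functionD f g).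

Lemma partial_add i (f g : testfun R d) :
  partial i (add_testfun f g) = (fun x => partial i f x + partial i g x).
Proof.
apply/funext => x; apply: (@deriveD _ _ _ (f : E -> R^o) (g : E -> R^o));
  exact: testfun_derivable.
Qed.

(** The support is transported by the inverse map, which sends the interior of
    the cube to an open subset of the cube, hence into its interior. *)
Lemma test_function_affine (f : testfun R d) (a b : E) (r s : R) :
  cancel (affine_map a r) (affine_map b s) -> cancel (affine_map b s) (affine_map a r) ->
  (forall x, cube R d x -> cube R d (affine_map b s x)) ->
  test_function (fun x => f (affine_map a r x)).
Proof.
move=> AK BK BC; apply: (@test_function_sub _ (affine_map b s @` support f)).
- by apply: smooth_affine_comp; exact: testfun_smooth.
- apply: continuous_compact; last exact: testfun_supportK.
  apply: continuous_subspaceT; exact: affine_map_continuous.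
- move=> _ [x fx <-].
  have : nbhs (affine_map b s x) (affine_map a r @^-1` (cube R d)°).
    apply: open_nbhs_nbhs; split; last by rewrite /preimage/= BK; exact: testfun_support_cube fx.
    apply: open_comp; last exact: open_interior.
    by move=> y _; exact: affine_map_continuous.
  apply: filterS => y /=; rewrite -{2}[y]AK => h.
  by apply: BC; exact: interior_subset.
- by move=> x fx; exists (affine_map a r x); rewrite ?AK//; exact: supportP.
Qed.

Lemma testfun_bounded (f : testfun R d) : exists2 M, 0 < M & forall x, `|f x| <= M.
Proof.
have [M M0 fM] := cube_bounded (@testfun_continuous _ _ f); exists M => // x.
have [/fM//|/testfun_out ->] := pselect (cube R d x).
by rewrite normr0 ltW.
Qed.

Lemma cube_measure1 : mu (cube R d) = 1%E.
Proof.
rewrite cubeE (@lebesgue_rV_box R d (fun=> `[0, 1]%classic))//; apply: big1 => i _.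
by rewrite lebesgue_measure_itv/= lte_fin ltr01 oppr0 adde0.
Qed.

Lemma integrable_bounded (g : E -> R) (M : R) (B D : set E) : measurable_fun setT g ->
  measurable B -> (mu B < +oo)%E -> measurable D ->
  (forall x, `|g x| <= M) -> (forall x, ~ B x -> g x = 0) ->
  mu.-integrable D (EFin \o g).
Proof.
move=> mg mB Boo mD gM g0.
apply: (@integrableS _ _ _ mu setT) => //.
have -> : EFin \o g = (EFin \o g) \_ B.
  apply/funext => x; rewrite patchE; case: ifPn => // /negP xB.
  by rewrite /= g0// => Bx; apply: xB; rewrite inE.
apply/(integrable_mkcond _ mB).
apply: measurable_bounded_integrable => //; first exact: measurable_funTS.
by exists M; split; [exact: num_real|move=> N MN x _ /=; rewrite (le_trans (gM x))// ltW].
Qed.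

Lemma testfun_integrable (f : testfun R d) (D : set E) : measurable D ->
  mu.-integrable D (EFin \o f).
Proof.
move=> mD; have [M _ fM] := testfun_bounded f.
apply: (integrable_bounded (M := M) (B := cube R d)) => //.
- apply: continuous_measurable_rVR; exact: testfun_continuous.
- exact: cube_measurable.
- by rewrite [ltLHS]cube_measure1 ltry.
- by move=> x; exact: testfun_out.
Qed.

(** Contains every translate of the cube by a vector of sup-norm at most 1. *)
Definition big_box : set E := [set x | forall i, `[-1, 2]%classic (x 0 i)].

Lemma big_box_measurable : measurable big_box.
Proof. by apply: (@box_measurable R d (fun=> `[-1, 2]%classic)). Qed.

Lemma big_box_fin : (mu big_box < +oo)%E.
Proof.
rewrite [ltLHS](@lebesgue_rV_box R d (fun=> `[-1, 2]%classic))//.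
rewrite (eq_bigr (fun=> (2 - -1 : R)%:E)); first by rewrite -(big_morph EFin (@EFinM R) erefl) ltry.
by move=> i _; rewrite lebesgue_measure_itv/= lte_fin ifT ?EFinB//; lra.
Qed.

(** The integral of the derivative is the derivative at 0 of
    t |-> int_D f(x + t e_i), by differentiation under the integral sign; a
    Lipschitz bound for that function is therefore a bound for the integral. *)
Lemma integral_partial_le (f : testfun R d) i (D : set E) (M : R) : measurable D ->
  (forall t, 0 < t ->
    `|\int[mu]_(x in D) f (affine_map (t *: e_ i) 1 x) - \int[mu]_(x in D) f x| <= M * t) ->
  `|\int[mu]_(x in D) partial i f x| <= M.
Proof.
move=> mD fM; have [C C0 fC] := testfun_bounded (partial_testfun i f).
pose F (t : R) (x : E) : R := f (affine_map (t *: e_ i) 1 x).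
have FE t x : F t x = f (x + t *: e_ i) by rewrite /F /affine_map scale1r addrC.
have F0 x : F 0 x = f x by rewrite FE scale0r addr0.
have dF (t : R) (x : E) : is_derive t 1 (F ^~ x : R -> R^o) (partial i f (x + t *: e_ i)).
  rewrite (_ : F ^~ x = fun r => f (x + r *: e_ i)); last by apply/funext => r; rewrite FE.
  by apply: is_derive_line; apply: smooth_is_derive; exact: testfun_smooth.
have d1F t x : partial1of2 F t x = partial i f (x + t *: e_ i).
  by rewrite /partial1of2 derive1E; have [_ ->] := dF t x.
have cF t : continuous (F t).
  by move=> x; apply: continuous_comp; [exact: affine_map_continuous|exact: testfun_continuous].
have big t x : -1 < t < 1 -> ~ big_box x -> ~ cube R d (x + t *: e_ i).
  move=> /andP[t0 t1] nB cx; apply: nB => j; have := cx j.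
  rewrite /= in_itv/= !mxE eqxx/=; case: (j == i) => /=; lra.
have Fint t : -1 < t < 1 -> mu.-integrable D (EFin \o F t).
  move=> t1; have [K _ fK] := testfun_bounded f.
  apply: (integrable_bounded (M := K) (B := big_box)) => //.
  - exact: continuous_measurable_rVR.
  - exact: big_box_measurable.
  - exact: big_box_fin.
  - by move=> x; exact: fK.
  - by move=> x nB; rewrite FE; apply: testfun_out; exact: big.
pose G (x : E) : R := C * \1_big_box x.
have Gint : mu.-integrable D (EFin \o G).
  apply: (integrable_bounded (M := C) (B := big_box)) => //.
  - by apply: measurable_funM => //; apply: measurable_indic; exact: big_box_measurable.
  - exact: big_box_measurable.
  - exact: big_box_fin.
  - move=> x; rewrite /G indicE; case: (_ \in _); rewrite ?mulr1 ?mulr0 ?normr0 ?gtr0_norm//.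
    exact: ltW.
  - by move=> x nB; rewrite /G indicE memNset// mulr0.
have G0 x : 0 <= G x by rewrite /G mulr_ge0// ltW.
have itv (t : R) : `]-1, 1[%classic t -> -1 < t < 1 by rewrite /= in_itv.
have H := @cvg_differentiation_under_integral R _ _ mu F D mD 0 (-1) 1 _
  (fun t Dt => Fint t (itv t Dt)) (fun t x _ _ => @ex_derive _ _ _ _ _ _ _ (dF t x)) G G0 Gint _.
have {}H : (fun h : R => h^-1 *:
      ((\int[mu]_(y in D) F (h + 0) y) - \int[mu]_(y in D) F 0 y)) h @[h --> 0^'] -->
    \int[mu]_(x in D) partial i f x.
  have -> : \int[mu]_(x in D) partial i f x = \int[mu]_(x in D) partial1of2 F 0 x.
    by apply: eq_Rintegral => x _; rewrite d1F scale0r addr0.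
  apply: H; first by rewrite /= in_itv/=; lra.
  move=> t x /itv t1 _; rewrite d1F /G indicE.
  case: (boolP (x \in big_box)) => [_|/negP nB]; first by rewrite mulr1; exact: fC.
  rewrite mulr0 -[partial i f _]/(partial_testfun i f _) testfun_out ?normr0//.
  by apply: big => // Bx; apply: nB; rewrite inE.
have {}H := cvg_dnbhs_at_right H.
apply: (@closed_cvg _ _ _ _ _ (fun r : R => `|r| <= M) _ _ _ H).
  by apply: (@closed_comp _ _ (fun r : R => `|r|) [set r | r <= M]);
    [move=> r _; exact: norm_continuous|exact: closed_le].
near=> h; have h0 : 0 < h by near: h; exact: nbhs_right_gt.
rewrite addr0 normrZ normfV (gtr0_norm h0) ler_pdivrMl// mulrC.
under [X in _ - X]eq_Rintegral do rewrite F0.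
exact: fM.
Unshelve. all: by end_near.
Qed.

Lemma Rintegral_translate (f : testfun R d) (a : E) (D : set E) : measurable D ->
  \int[mu]_(x in affine_map a 1 @^-1` D) f (affine_map a 1 x) = \int[mu]_(x in D) f x.
Proof.
move=> mD; rewrite Rintegral_affine//; last exact: testfun_integrable.
by rewrite invr1 expr1n mul1r.
Qed.

Lemma integral_partial_setT (f : testfun R d) i : \int[mu]_x partial i f x = 0.
Proof.
apply/eqP; rewrite -normr_le0; apply: integral_partial_le => // t t0.
rewrite mul0r -[X in _ - X](Rintegral_translate f (t *: e_ i))//.
by rewrite preimage_setT subrr normr0.
Qed.

Definition half_space i (c : R) : set E := [set x | x 0 i < c].

Lemma half_space_measurable i c : measurable (half_space i c).
Proof.
apply: open_measurable_rV; rewrite (_ : half_space i c = (fun x : E => x 0 i) @^-1` [set r | r < c])//.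
by apply: open_comp; [move=> x _; exact: coord_continuous|exact: open_lt].
Qed.

(** The two half-spaces differ by a slab that meets the cube in a set of
    measure at most [t]. *)
Lemma slab_integral (f : testfun R d) i (c t K : R) : 0 < t -> 0 <= K ->
  (forall x, `|f x| <= K) ->
  `|\int[mu]_(x in half_space i (c + t)) f x - \int[mu]_(x in half_space i c) f x| <= K * t.
Proof.
move=> t0 K0 fK.
pose A (j : 'I_d) : set R := if j == i then `[c, c + t[%classic else `[0, 1]%classic.
have mA j : measurable (A j) by rewrite /A; case: ifP.
pose B : set E := [set x | forall j, A j (x 0 j)].
have mB : measurable B by exact: box_measurable.
have muB : mu B = t%:E.
  rewrite lebesgue_rV_box// (bigD1 i)//= big1 ?mule1; last first.
    move=> j ji; rewrite /A (negbTE ji) lebesgue_measure_itv/= lte_fin ltr01.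
    by rewrite oppr0 adde0.
  rewrite /A eqxx lebesgue_measure_itv/= lte_fin ifT; last by rewrite ltrDl.
  by rewrite -EFinB addrAC subrr add0r.
pose S : set E := half_space i (c + t) `\` half_space i c.
have mS : measurable S by apply: measurableD; exact: half_space_measurable.
have -> : half_space i (c + t) = half_space i c `|` S.
  by rewrite /S setDUK// => x /= /lt_trans; apply; rewrite ltrDl.
rewrite Rintegral_setU//; first last.
- by rewrite disj_set2E /S setDIK.
- by apply: testfun_integrable; apply: measurableU => //; exact: half_space_measurable.
- exact: half_space_measurable.
rewrite addrAC subrr add0r.
have -> : \int[mu]_(x in S) f x = \int[mu]_(x in B) f x.
  rewrite Rintegral_mkcond [RHS]Rintegral_mkcond; apply: eq_Rintegral => x _.
  rewrite !patchE; case: ifPn => [/set_mem|/negP] Sx; case: ifPn => [/set_mem|/negP] Bx //.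
    apply: testfun_out => cx; apply: Bx; rewrite inE => j; rewrite /A; case: eqP => [->|_]; last first.
      by rewrite /= in_itv; exact: cx.
    have [/= h1 h2] := Sx; rewrite /= in_itv/= h1 andbT leNgt.
    exact/negP.
  exfalso; apply: Sx; rewrite inE; have := Bx i; rewrite /A eqxx /= in_itv/= => /andP[h1 h2].
  by split=> //=; apply/negP; rewrite -leNgt.
apply: le_trans (le_normr_Rintegral mB (testfun_integrable _ mB)) _.
have Boo : (mu B < +oo)%E by rewrite muB ltry.
apply: (@le_trans _ _ (\int[mu]_(x in B) cst K x)).
  apply: le_Rintegral => //.
  - by have := integrable_abse (testfun_integrable f mB); apply: eq_integrable.
  - apply: measurable_bounded_integrable => //; exists K; split; first exact: num_real.
    by move=> N KN x _ /=; rewrite ger0_norm// ltW.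
by rewrite Rintegral_cst// [X in fine X]muB.
Qed.

(** Translating along [e_j] maps the half-space to itself, except for [j = i],
    when it adds a slab. *)
Lemma integral_partial_half_space (f : testfun R d) i j (c K : R) : 0 <= K ->
  (forall x, `|f x| <= K) ->
  `|\int[mu]_(x in half_space i c) partial j f x| <= if j == i then K else 0.
Proof.
move=> K0 fK; apply: integral_partial_le; first exact: half_space_measurable.
move=> t t0; case: eqP => [->|/eqP ji].
  have <- : affine_map (t *: e_ i) 1 @^-1` half_space i (c + t) = half_space i c.
    apply/seteqP; split => x; rewrite /preimage /half_space/= /affine_map scale1r !mxE eqxx;
    rewrite eqxx/=; lra.
  rewrite Rintegral_translate; last exact: half_space_measurable.
  rewrite (_ : _ @^-1` _ = half_space i c); first exact: slab_integral.
  apply/seteqP; split => x; rewrite /preimage /half_space/= /affine_map scale1r !mxE eqxx;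
  rewrite eqxx/=; lra.
have {1}<- : affine_map (t *: e_ j) 1 @^-1` half_space i c = half_space i c.
  apply/seteqP; split => x; rewrite /preimage /half_space/= /affine_map scale1r !mxE eqxx;
  by rewrite eq_sym (negbTE ji)/= mulr0 add0r.
rewrite Rintegral_translate; last exact: half_space_measurable.
by rewrite subrr normr0 mul0r.
Qed.
End TestCalculus.
(** * Classes of functions; indicators of half-spaces in BV *)

Section BVElements.
Local Open Scope quotient_scope.
Context (R : realType) (d : nat).
Local Notation E := 'rV[R]_d.
Local Notation mu := (lebesgue_rV R d).
Local Notation e_ i := (delta_mx 0 i : E).
Local Notation cube := (cube R d).
Implicit Types (i : 'I_d).

Lemma integrable_mul_continuous (u g : E -> R) : mu.-integrable cube (EFin \o u) ->
  continuous g -> mu.-integrable cube (EFin \o (fun x => u x * g x)).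
Proof.
move=> iu cg; have [M M0 gM] := cube_bounded cg.
have mg : measurable_fun cube g by exact: measurable_funTS (continuous_measurable_rVR cg).
have bg : [bounded g x | x in cube].
  exists M; split; first exact: num_real.
  by move=> N MN x cx /=; rewrite (le_trans (gM x cx))// ltW.
have := integrableMl (@cube_measurable R d) iu mg bg.
by apply: eq_integrable => //; exact: cube_measurable.
Qed.

Section L1_class.
Variable u : E -> R^o.
Hypothesis iu : mu.-integrable cube (EFin \o u).

Lemma L1_class_subproof : u \in @cube_integrable R d.
Proof. by rewrite inE. Qed.

Let u_fun : integrable_fun R d := exist (fun v => v \in @cube_integrable R d) u L1_class_subproof.

(** The class of an integrable function; its representative is only known up
    to a null set, which the next lemmas take care of. *)
Definition L1_class : L1 R d := \pi_(L1 R d) u_fun.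

Lemma L1_class_ae : {ae mu, forall x, cube x -> L1_fun L1_class x = u x}.
Proof.
have : repr L1_class - u_fun \in @ae_null R d.
  by apply/pi_L1_eq; rewrite reprK.
by rewrite inE; apply: filterS => x + cx => /(_ cx) /eqP; rewrite subr_eq0 => /eqP.
Qed.

Lemma pairing_L1_class g : continuous g ->
  pairing L1_class g = \int[mu]_(x in cube) (u x * g x).
Proof.
move=> cg; congr fine; apply: ae_eq_integral.
- exact: cube_measurable.
- by case/integrableP : (pairing_integrable L1_class cg).
- by case/integrableP : (integrable_mul_continuous iu cg).
- by apply: filterS L1_class_ae => x h cx /=; rewrite h.
Qed.

Lemma L1_norm_L1_class : L1_norm L1_class = \int[mu]_(x in cube) `|u x|.
Proof.
congr fine; apply: ae_eq_integral.
- exact: cube_measurable.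
- by case/integrableP : (L1_norm_int L1_class).
- by case/integrableP : (integrable_abse iu).
- by apply: filterS L1_class_ae => x h cx /=; rewrite h.
Qed.
End L1_class.

Lemma pairing_sum (u : L1 R d) (s : seq 'I_d) (g : 'I_d -> E -> R) :
  (forall i, continuous (g i)) ->
  pairing u (fun x => \sum_(i <- s) g i x) = \sum_(i <- s) pairing u (g i).
Proof.
move=> cg; suff [] : pairing u (fun x => \sum_(i <- s) g i x) = \sum_(i <- s) pairing u (g i) /\
    continuous (fun x => \sum_(i <- s) g i x) by [].
elim: s => [|i s [IH cs]].
  rewrite big_nil (_ : (fun x => _) = (fun=> 0)); last by apply/funext => x; rewrite big_nil.
  split; last by move=> x; apply: cst_continuous.
  rewrite /pairing; under eq_Rintegral do rewrite mulr0.
  by rewrite Rintegral_cst ?mul0r//; exact: cube_measurable.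
rewrite (_ : (fun x => _) = (fun x => g i x + \sum_(j <- s) g j x)); last first.
  by apply/funext => x; rewrite big_cons.
split; last by move=> x; exact: (cvgD (cg i x) (cs x)).
by rewrite big_cons -IH; exact: pairingDr.
Qed.

Lemma pairing_divergence (u : L1 R d) (phi : 'I_d -> testfun R d) :
  pairing u (divergence phi) = \sum_(i < d) pairing u (partial i (phi i)).
Proof. by apply: pairing_sum => i; exact: partial_continuous. Qed.

Lemma supnorm_le1 (f : testfun R d) : (supnorm f <= 1)%E <-> forall x, `|f x| <= 1.
Proof.
split=> [/supnormP h x|h]; last by apply/supnormP => x _.
have [/h//|/testfun_out ->] := pselect (cube x).
by rewrite normr0 ler01.
Qed.

Section BV_class.
Variables (u : L1 R d) (C : R).
Hypothesis uC : (Defs.variation u <= C%:E)%E.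

Lemma BV_class_subproof : u \in @Defs.bounded_variation R d.
Proof. by rewrite inE; apply: le_lt_trans uC _; exact: ltry. Qed.

Definition BV_class : BV R d := exist (fun v => v \in @Defs.bounded_variation R d) u BV_class_subproof.

Lemma BV_class_norm : `|BV_class| <= L1_norm u + C.
Proof.
rewrite -[leLHS]/(L1_norm u + fine (Defs.variation u)) lerD2l -lee_fin fineK//.
exact: (@Defs.variation_fin_num _ _ BV_class).
Qed.
End BV_class.

Lemma indicator_integrable i c :
  mu.-integrable cube (EFin \o (\1_(half_space i c) : E -> R)).
Proof.
apply: measurable_bounded_integrable.
- exact: cube_measurable.
- by rewrite [ltLHS]cube_measure1 ltry.
- by apply: measurable_funTS; apply: measurable_indic; exact: half_space_measurable.
- exists 1; split; first exact: num_real.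
  move=> N N1 x _ /=; rewrite indicE ger0_norm// (le_trans _ (ltW N1))//.
  by case: (_ \in _).
Qed.

Definition strip_L1 i c : L1 R d := L1_class (indicator_integrable i c).

Lemma pairing_strip i c (f : testfun R d) :
  pairing (strip_L1 i c) f = \int[mu]_(x in half_space i c) f x.
Proof.
rewrite pairing_L1_class; last exact: testfun_continuous.
rewrite Rintegral_mkcond [RHS]Rintegral_mkcond; apply: eq_Rintegral => x _.
rewrite !patchE indicE; case: ifPn => [/set_mem|/negP] cx.
  by case: ifPn => _; rewrite ?mul1r ?mul0r.
by rewrite testfun_out ?if_same// => h; apply: cx; rewrite inE.
Qed.

Lemma variation_strip i c : (Defs.variation (strip_L1 i c) <= 1%:E)%E.
Proof.
apply: ub_ereal_sup => _ [phi /= p1 <-]; rewrite lee_fin pairing_divergence.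
rewrite (le_trans (ler_norm _))// (le_trans (ler_norm_sum _ _ _))//.
apply: (@le_trans _ _ (\sum_(j < d) if j == i then 1 else 0)).
  apply: ler_sum => j _; rewrite -[partial j _]/(testfun_fun (partial_testfun j (phi j))).
  rewrite pairing_strip; apply: integral_partial_half_space => // x.
  by move/supnorm_le1 : (p1 j); apply.
by rewrite -big_mkcond/= big_pred1_eq.
Qed.

Lemma L1_norm_strip i c : L1_norm (strip_L1 i c) <= 1.
Proof.
rewrite L1_norm_L1_class.
apply: (@le_trans _ _ (\int[mu]_(x in cube) cst 1 x)).
  apply: le_Rintegral.
  - exact: cube_measurable.
  - have := integrable_abse (indicator_integrable i c); apply: eq_integrable => //.
    exact: cube_measurable.
  - apply: measurable_bounded_integrable => //; first exact: cube_measurable.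
      by rewrite [ltLHS]cube_measure1 ltry.
    exists 1; split; first exact: num_real.
    by move=> N N1 x _ /=; rewrite normr1 ltW.
  - by move=> x _; rewrite indicE ger0_norm//=; case: (_ \in _).
rewrite Rintegral_cst; last exact: cube_measurable.
by rewrite [X in fine X]cube_measure1 mul1r.
Qed.

(** The indicator of {x_i < c}: for small [c] it probes the trace on the face
    x_i = 0, and for [c > 1] it is the constant 1 on the cube. *)
Definition strip i c : BV R d := BV_class (variation_strip i c).

Lemma strip_norm i c : `|strip i c| <= 2.
Proof.
apply: le_trans (BV_class_norm _) _.
by have := L1_norm_strip i c; lra.
Qed.
End BVElements.

(** * Homotheties acting on BV *)

Lemma sum_update (R : zmodType) (I : finType) (A B : I -> R) (i : I) (r : R) :
  B i = A i + r -> (forall j, j != i -> B j = A j) -> \sum_j A j + r = \sum_j B j.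
Proof.
move=> Bi Bj; rewrite (bigD1 i)//= [RHS](bigD1 i)//= Bi addrAC; congr (_ + _).
by apply: eq_bigr => j /Bj ->.
Qed.

Section Dilation.
Context (R : realType) (d : nat).
Local Notation E := 'rV[R]_d.
Local Notation mu := (lebesgue_rV R d).
Local Notation cube := (cube R d).
Implicit Types (i : 'I_d).
Variables (s : R) (s0 : 0 < s) (s1 : s <= 1).

(** The homothety of ratio [s] with centre (1,...,1), which for
    [s < 1] moves the cube into itself and away from all faces x_i = 0. *)
Definition shrink : E -> E := affine_map (const_mx (1 - s)) s.
Definition stretch : E -> E := affine_map (const_mx (- (1 - s) / s)) s^-1.

Lemma shrinkK : cancel shrink stretch.
Proof.
move=> x; apply/rowP => j; rewrite /stretch /shrink /affine_map !mxE.
by field; rewrite gt_eqF.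
Qed.

Lemma stretchK : cancel stretch shrink.
Proof.
move=> x; apply/rowP => j; rewrite /stretch /shrink /affine_map !mxE.
by field; rewrite gt_eqF.
Qed.

Lemma shrink_cube x : cube x -> cube (shrink x).
Proof.
move=> cx i; have /andP[x0 x1] := cx i; rewrite /shrink /affine_map !mxE; apply/andP; split.
  by rewrite addr_ge0 ?mulr_ge0 ?subr_ge0// ltW.
by rewrite -lerBrDl opprB addrCA subrr addr0 ler_piMr// ltW.
Qed.

Lemma stretch_cube i x : cube (stretch x) -> 1 - s <= x 0 i.
Proof.
move=> /(_ i) /andP[+ _]; rewrite /stretch /affine_map !mxE (mulrC s^-1) -mulrDl.
by rewrite pmulr_lge0 ?invr_gt0// addrC subr_ge0.
Qed.

Definition dilate_testfun (f : testfun R d) : testfun R d :=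
  exist _ _ (test_function_affine f stretchK shrinkK shrink_cube).

Lemma dilate_testfunE f x : dilate_testfun f x = f (stretch x).
Proof. by []. Qed.

Lemma partial_dilate i (f : testfun R d) x :
  partial i f (stretch x) = s * partial i (dilate_testfun f) x.
Proof.
rewrite [partial i (dilate_testfun f)](partial_affine_comp i _ _ (@testfun_smooth _ _ f)).
by rewrite mulrA mulfV ?gt_eqF// mul1r.
Qed.

Lemma cube_sub_shrink : cube `<=` shrink @^-1` cube.
Proof. by move=> x; exact: shrink_cube. Qed.

Lemma shrink_cube_measurable : measurable (shrink @^-1` cube).
Proof. by apply: measurable_affine_preimage; exact: cube_measurable. Qed.

Lemma dilate_integrable (u : L1 R d) : mu.-integrable cube (EFin \o ((fun x => u (shrink x)) : E -> R)).
Proof.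
have iu := integrable_affine (const_mx (1 - s)) s0 (@cube_measurable R d) (L1_int u).
exact: (integrableS shrink_cube_measurable (@cube_measurable R d) cube_sub_shrink iu).
Qed.

Definition dilate_L1 (u : L1 R d) : L1 R d := L1_class (dilate_integrable u).

Let k : R := s^-1 ^+ d.

Lemma pairing_dilate (u : L1 R d) (f : testfun R d) :
  pairing (dilate_L1 u) f = k * pairing u (dilate_testfun f).
Proof.
rewrite pairing_L1_class; last exact: testfun_continuous.
have iug := pairing_integrable u (@testfun_continuous _ _ (dilate_testfun f)).
rewrite -(Rintegral_affine (const_mx (1 - s)) s0 (@cube_measurable R d) iug).
rewrite Rintegral_mkcond [RHS]Rintegral_mkcond; apply: eq_Rintegral => x _.
rewrite !patchE; case: ifPn => [/set_mem|/negP] cx.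
  rewrite ifT; last by rewrite inE; exact: shrink_cube.
  by rewrite dilate_testfunE -/(shrink x) shrinkK.
case: ifPn => // _; rewrite dilate_testfunE -/(shrink x) shrinkK testfun_out ?mulr0//.
by move=> h; apply: cx; rewrite inE.
Qed.

Lemma L1_norm_dilate (u : L1 R d) : L1_norm (dilate_L1 u) <= k * L1_norm u.
Proof.
rewrite L1_norm_L1_class.
rewrite -(Rintegral_affine (const_mx (1 - s)) s0 (@cube_measurable R d) (L1_norm_int u)).
have iu := integrable_affine (const_mx (1 - s)) s0 (@cube_measurable R d) (L1_norm_int u).
rewrite /Rintegral fine_le//.
- apply: integrable_fin_num; first exact: cube_measurable.
  exact: (integrableS shrink_cube_measurable (@cube_measurable R d) cube_sub_shrink iu).
- by apply: integrable_fin_num => //; exact: shrink_cube_measurable.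
- apply: ge0_subset_integral; last exact: cube_sub_shrink.
  - exact: cube_measurable.
  - exact: shrink_cube_measurable.
  - by case/integrableP : iu.
  - by move=> x _; rewrite lee_fin.
Qed.

Lemma pairing_dilate_partial (u : L1 R d) i (f : testfun R d) :
  pairing (dilate_L1 u) (partial i f) = k * s * pairing u (partial i (dilate_testfun f)).
Proof.
rewrite -[partial i f]/(testfun_fun (partial_testfun i f)) pairing_dilate -mulrA; congr (_ * _).
rewrite -pairingZr; last exact: partial_continuous.
by congr pairing; apply/funext => x; rewrite -partial_dilate.
Qed.

Lemma k_ge1 : 1 <= k.
Proof. by rewrite /k exprn_ege1// invf_ge1. Qed.

(** A field transported to the shrunk cube and a multiple of [psi], which lives
    in the strip x_i < 1 - s, have disjoint supports.  Adding the latter to the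
    [i]-th component therefore keeps the field admissible for [u]: this is the
    superadditivity of the variation over disjoint regions. *)
Lemma variation_dilate i (u : BV R d) (psi : testfun R d) :
  (forall x, `|psi x| <= 1) -> (forall x, psi x != 0 -> x 0 i < 1 - s) ->
  (Defs.variation (dilate_L1 (val u)) <=
   (k * (fine (Defs.variation (val u)) - `|pairing (val u) (partial i psi)|))%:E)%E.
Proof.
move=> psi1 psis; set r := `|_|; set V := fine _.
have Vadm (chi : 'I_d -> testfun R d) : (forall j x, `|chi j x| <= 1) ->
    pairing (val u) (divergence chi) <= V.
  move=> c1; rewrite -lee_fin (fineK (Defs.variation_fin_num u)).
  apply: le_trans (Defs.variation_ub (val u) (phi := chi) _).
    by rewrite lee_fin ler_norm.
  by move=> j; apply/supnorm_le1.
pose sg : R := if 0 <= pairing (val u) (partial i psi) then 1 else -1.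
have sgr : sg * pairing (val u) (partial i psi) = r.
  rewrite /sg /r; case: ifPn => [h|]; first by rewrite mul1r ger0_norm.
  by rewrite -ltNge => h; rewrite mulN1r ltr0_norm.
have sg1 : `|sg| = 1 by rewrite /sg; case: ifP; rewrite ?normrN normr1.
have add_psi (phi : 'I_d -> testfun R d) : (forall j x, `|phi j x| <= 1) ->
    pairing (val u) (divergence (fun j => dilate_testfun (phi j))) + r <= V.
  move=> phi1.
  pose chi j := if j == i then add_testfun (dilate_testfun (phi j)) (scale_testfun sg psi)
    else dilate_testfun (phi j).
  have -> : pairing (val u) (divergence (fun j => dilate_testfun (phi j))) + r =
      pairing (val u) (divergence chi).
    have chi_i : pairing (val u) (partial i (chi i)) =
        pairing (val u) (partial i (dilate_testfun (phi i))) + r.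
      rewrite /chi eqxx partial_add partial_scale pairingDr.
      - by rewrite pairingZr ?sgr//; exact: partial_continuous.
      - exact: partial_continuous.
      - by move=> x; exact: (cvgM (cvg_cst sg) (@partial_continuous _ _ i psi x)).
    rewrite (pairing_divergence _ chi) (pairing_divergence _ (fun j => dilate_testfun (phi j))).
    apply: (sum_update (i := i)) chi_i _ => j ji.
    by rewrite /chi (negbTE ji).
  apply: Vadm => j x; rewrite /chi; case: eqP => [->|_]; last first.
    by rewrite dilate_testfunE.
  rewrite /= -[X in `|X|]/(phi i (stretch x) + sg * psi x).
  have [->|pn0] := eqVneq (psi x) 0; first by rewrite mulr0 addr0.
  rewrite (@testfun_out _ _ (phi i)) ?add0r ?normrM ?sg1 ?mul1r//.
  by move=> /(@stretch_cube i); apply/negP; rewrite -ltNge psis.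
have rV : r <= V.
  have := add_psi (fun=> scale_testfun 0 psi) _.
  rewrite pairing_divergence big1 ?add0r => [|j _]; last first.
    rewrite -[partial j _]/(partial j (scale_testfun 0 (dilate_testfun psi))).
    by rewrite partial_scale pairingZr ?mul0r//; exact: partial_continuous.
  by apply => j x; rewrite /= mul0r normr0.
apply: ub_ereal_sup => _ [phi /= p1 <-]; rewrite lee_fin pairing_divergence.
under eq_bigr do rewrite pairing_dilate_partial.
rewrite -mulr_sumr -pairing_divergence -mulrA ler_wpM2l//.
  exact: le_trans ler01 k_ge1.
have : pairing (val u) (divergence (fun j => dilate_testfun (phi j))) <= V - r.
  by rewrite lerBrDr; apply: add_psi => j x; move/supnorm_le1 : (p1 j); apply.
set X := pairing _ _ => XV; apply: (@le_trans _ _ (s * (V - r))).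
  by rewrite ler_wpM2l// ltW.
by rewrite ler_piMl// subr_ge0.
Qed.

Lemma dilate_BV_subproof (u : BV R d) : exists C : R, (Defs.variation (dilate_L1 (val u)) <= C%:E)%E.
Proof.
exists (k * s * fine (Defs.variation (val u))).
apply: ub_ereal_sup => _ [phi /= p1 <-]; rewrite lee_fin pairing_divergence.
under eq_bigr do rewrite pairing_dilate_partial.
rewrite -mulr_sumr -pairing_divergence ler_wpM2l//.
  by rewrite mulr_ge0 ?(ltW s0)//; exact: le_trans ler01 k_ge1.
rewrite -lee_fin (fineK (Defs.variation_fin_num u)).
apply: ereal_sup_ubound; exists (fun j => dilate_testfun (phi j)); last by [].
move=> j; apply/(supnorm_le1 (dilate_testfun _)) => x.
by rewrite dilate_testfunE; move/supnorm_le1 : (p1 j); apply.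
Qed.

Definition dilate_BV (u : BV R d) : BV R d := BV_class (projT2 (cid (dilate_BV_subproof u))).

(** A functional seen through the dilation and one that only sees the strip
    x_i < 1 - s cannot both use up the norm of [u]. *)
Lemma dilate_BV_norm_add i (u : BV R d) (psi : testfun R d) :
  (forall x, `|psi x| <= 1) -> (forall x, psi x != 0 -> x 0 i < 1 - s) ->
  `|dilate_BV u| + `|pairing (val u) (partial i psi)| <= k * `|u|.
Proof.
move=> psi1 psis; have V := variation_dilate u psi1 psis.
rewrite -[`|dilate_BV u|]/(L1_norm (dilate_L1 (val u)) + fine (Defs.variation (dilate_L1 (val u)))).
rewrite -[`|u|]/(L1_norm (val u) + fine (Defs.variation (val u))) mulrDr -addrA lerD ?L1_norm_dilate//.
move: V; rewrite -[X in (X <= _)%E](fineK (Defs.variation_fin_num (dilate_BV u))) lee_fin.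
set r := `|_| => V; apply: (@le_trans _ _ (k * (fine (Defs.variation (val u)) - r) + k * r)).
  by apply: lerD => //; rewrite ler_peMl ?k_ge1//; exact: normr_ge0.
by rewrite -mulrDr subrK.
Qed.

(** The tuple representing the adjoint of [dilate_BV]: the Jacobian contributes
    s^-d, and each derivative a factor [s]. *)
Definition dilate_tuple (phi : 'I_d.+1 -> testfun R d) (j : 'I_d.+1) : testfun R d :=
  scale_testfun (if j == ord0 then k else k * s) (dilate_testfun (phi j)).

Lemma tuple_pairing_dilate (phi : 'I_d.+1 -> testfun R d) (u : BV R d) :
  tuple_pairing phi (dilate_BV u) = tuple_pairing (dilate_tuple phi) u.
Proof.
have e0 : pairing (dilate_L1 (val u)) (phi ord0) = pairing (val u) (dilate_tuple phi ord0).
  by rewrite pairing_dilate /dilate_tuple eqxx -pairingZr//; exact: testfun_continuous.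
have ei i : pairing (dilate_L1 (val u)) (partial i (phi (lift ord0 i))) =
    pairing (val u) (partial i (dilate_tuple phi (lift ord0 i))).
  rewrite pairing_dilate_partial /dilate_tuple partial_scale pairingZr//.
  exact: partial_continuous.
have es : \sum_(i < d) pairing (dilate_L1 (val u)) (partial i (phi (lift ord0 i))) =
    \sum_(i < d) pairing (val u) (partial i (dilate_tuple phi (lift ord0 i))).
  by apply: eq_bigr => i _; exact: ei.
exact: (congr2 (fun a b : R => a + b) e0 es).
Qed.
End Dilation.

(** * Functionals of tuples of test functions *)

Section TupleFunctionals.
Context (R : realType) (d : nat).
Local Notation E := 'rV[R]_d.
Local Notation mu := (lebesgue_rV R d).
Local Notation cube := (cube R d).
Implicit Types (i : 'I_d) (phi psi : 'I_d.+1 -> testfun R d).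

Definition comb_testfun (a : R) (f g : testfun R d) := add_testfun (scale_testfun a f) g.

Lemma comb_testfunE a f g x : comb_testfun a f g x = a * f x + g x.
Proof. by []. Qed.

Lemma partial_comb i a f g :
  partial i (comb_testfun a f g) = (fun x => a * partial i f x + partial i g x).
Proof. by rewrite /comb_testfun partial_add partial_scale. Qed.

Lemma pairing_comb (u : L1 R d) a (f g : E -> R) : continuous f -> continuous g ->
  pairing u (fun x => a * f x + g x) = a * pairing u f + pairing u g.
Proof.
move=> cf cg; rewrite pairingDr//; first by rewrite pairingZr.
by move=> x; exact: (cvgM (cvg_cst a) (cf x)).
Qed.

Lemma tuple_functionalE phi (u : BV R d) :
  dual_fun (tuple_functional phi) u =
  pairing (val u) (phi ord0) + pairing (val u) (divergence (fun i => phi (lift ord0 i))).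
Proof. by rewrite pairing_divergence. Qed.

Lemma dual_comb_ext (X : normedModType R) (a : R) (f g h : dual X) :
  (forall x, f x = a * g x + h x) -> f = a *: g + h.
Proof. by move=> e; apply: dual_ext => x; rewrite dual_funP. Qed.

Lemma eq_comb (a x x' y y' z z' : R) : x = x' -> y = y' -> z = z' ->
  x' = a * y' + z' -> x = a * y + z.
Proof. by move=> -> -> ->. Qed.

Lemma tuple_functional_comb a phi psi :
  tuple_functional (fun j => comb_testfun a (phi j) (psi j)) =
  a *: tuple_functional phi + tuple_functional psi.
Proof.
apply: dual_comb_ext => u.
have e0 : pairing (val u) (comb_testfun a (phi ord0) (psi ord0)) =
    a * pairing (val u) (phi ord0) + pairing (val u) (psi ord0).
  by apply: pairing_comb; exact: testfun_continuous.
have es : \sum_(i < d)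
      pairing (val u) (partial i (comb_testfun a (phi (lift ord0 i)) (psi (lift ord0 i)))) =
   a * (\sum_(i < d) pairing (val u) (partial i (phi (lift ord0 i)))) +
   \sum_(i < d) pairing (val u) (partial i (psi (lift ord0 i))).
  rewrite mulr_sumr -big_split; apply: eq_bigr => i _.
  by rewrite partial_comb pairing_comb//; exact: partial_continuous.
apply: (eq_comb (tuple_functionalE _ u) (tuple_functionalE phi u) (tuple_functionalE psi u)).
rewrite (pairing_divergence _ (fun i => comb_testfun a (phi (lift ord0 i)) (psi (lift ord0 i)))).
rewrite es e0 (pairing_divergence _ (fun i => phi (lift ord0 i))).
by rewrite (pairing_divergence _ (fun i => psi (lift ord0 i))) mulrDr addrACA.
Qed.

Lemma divergence_le (u : BV R d) (phi : 'I_d -> testfun R d) (M : R) : 0 < M ->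
  (forall j x, `|phi j x| <= M) ->
  `|pairing (val u) (divergence phi)| <= M * fine (Defs.variation (val u)).
Proof.
move=> M0 phiM.
have -> : pairing (val u) (divergence phi) =
    M * pairing (val u) (divergence (fun i => scale_testfun M^-1 (phi i))).
  rewrite divergence_scale pairingZr; last exact: divergence_continuous.
  by rewrite mulrA mulfV ?gt_eqF// mul1r.
rewrite normrM gtr0_norm// ler_wpM2l ?(ltW M0)//.
rewrite -lee_fin (fineK (Defs.variation_fin_num u)).
apply: Defs.variation_ub => j; apply/(supnorm_le1 (scale_testfun _ _)) => x.
rewrite -[X in `|X|]/(M^-1 * phi j x) normrM gtr0_norm ?invr_gt0//.
by rewrite ler_pdivrMl// mulr1.
Qed.

Lemma tuple_functional_norm_le phi (M : R) : 0 < M ->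
  (forall j x, `|phi j x| <= M) -> `|tuple_functional phi| <= M.
Proof.
move=> M0 phiM; apply: dual_norm_le; first exact: ltW.
move=> u; rewrite tuple_functionalE (le_trans (ler_normD _ _))//.
rewrite -[`|u|]/(L1_norm (val u) + fine (Defs.variation (val u))) mulrDr.
apply: lerD; last exact: divergence_le.
by apply: pairing_le => //; exact: testfun_continuous.
Qed.

Lemma lin_span_tuple (Phi : set (testfun R d)) x :
  lin_span (tuple_functionals Phi) x -> exists phi, x = tuple_functional phi.
Proof.
have [f0 _] : exists f : testfun R d, True.
  have h : test_function ((fun=> 0) : E -> R^o).
    apply: (test_function_sub (K := set0)) => //; first exact: smooth_cst.
      exact: compact0.
    by move=> y; rewrite eqxx.
  by exists (exist _ _ h).
move=> [n [c [a [aP ->]]]].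
have z : tuple_functional (fun=> scale_testfun 0 f0) = 0.
  apply/eqP; rewrite -normr_le0; apply/ler_addgt0Pr => e e0; rewrite add0r.
  by apply: tuple_functional_norm_le => // j y; rewrite /= mul0r normr0 ltW.
elim/big_ind: _.
- by exists (fun=> scale_testfun 0 f0).
- move=> _ _ [phi ->] [psi ->]; exists (fun j => comb_testfun 1 (phi j) (psi j)).
  by rewrite tuple_functional_comb scale1r.
- move=> i _; have [phi _ <-] := aP i.
  exists (fun j => comb_testfun (c i) (phi j) (scale_testfun 0 f0)).
  by rewrite tuple_functional_comb z addr0.
Qed.

Section DenseSubset.
Variables (Phi : set (testfun R d)) (Phi_dense : sup_dense Phi).

(** By homogeneity it is enough to approximate, in sup-norm, tuples bounded by 1. *)
Lemma tuple_in_W phi : tuple_functional phi \in closed_span (tuple_functionals Phi).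
Proof.
have [M M0 phiM] : exists2 M, 0 < M & forall j x, `|phi j x| <= M.
  have /choice[m hm] : forall j, exists m : R, 0 < m /\ forall x, `|phi j x| <= m.
    by move=> j; have [m m0 h] := testfun_bounded (phi j); exists m.
  exists (1 + \sum_j m j).
    by rewrite ltr_wpDr// sumr_ge0// => j _; apply: ltW; have [] := hm j.
  move=> j x; have [_ /(_ x) h] := hm j; rewrite (le_trans h)// (bigD1 j)//= addrCA lerDl.
  by rewrite addr_ge0// sumr_ge0// => l _; apply: ltW; have [] := hm l.
rewrite inE => B /nbhs_ballP[e /= e0 eB].
have d0 : 0 < e / 2 / M by rewrite !divr_gt0.
have /choice[g hg] : forall j, exists g, Phi g /\
    forall x, `|g x - M^-1 * phi j x| <= e / 2 / M.
  move=> j; have [|g gP hg] := Phi_dense (f := scale_testfun M^-1 (phi j)) _ d0.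
    apply/supnorm_le1 => x; rewrite -[X in `|X|]/(M^-1 * phi j x) normrM gtr0_norm ?invr_gt0//.
    by rewrite ler_pdivrMl// mulr1.
  exists g; split => // x; have [cx|ncx] := pselect (cube x); last first.
    by rewrite !testfun_out// mulr0 subrr normr0 ltW.
  by move/supnormP : (ltW hg); apply.
exists (M *: tuple_functional g); split.
  exists 1%N, (fun=> M), (fun=> tuple_functional g); split; last by rewrite big_ord1.
  by move=> _; exists g => //= j; have [] := hg j.
apply: eB; rewrite -ball_normE /=.
have -> : tuple_functional phi - M *: tuple_functional g =
   tuple_functional (fun j => comb_testfun (- M) (g j) (phi j)).
  by rewrite tuple_functional_comb scaleNr addrC.
apply: (@le_lt_trans _ _ (e / 2)); last by rewrite ltr_pdivrMr// ltr_pMr// ltr1n.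
apply: tuple_functional_norm_le; first exact: divr_gt0.
move=> j x; rewrite comb_testfunE mulNr addrC.
have [_ /(_ x)] := hg j.
have -> : phi j x - M * g j x = - M * (g j x - M^-1 * phi j x).
  by field; rewrite gt_eqF.
by rewrite normrM normrN (gtr0_norm M0) -ler_pdivlMl// (mulrC M^-1 (e / 2)).
Qed.

Definition W_tuple phi : W Phi :=
  exist (fun x => x \in closed_span (tuple_functionals Phi)) _ (tuple_in_W phi).

Lemma W_tuple_comb a phi psi :
  W_tuple (fun j => comb_testfun a (phi j) (psi j)) = a *: W_tuple phi + W_tuple psi.
Proof. by apply: val_inj; exact: tuple_functional_comb. Qed.

Lemma W_tuple_norm_le phi (M : R) : 0 < M ->
  (forall j x, `|phi j x| <= M) -> `|W_tuple phi| <= M.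
Proof. exact: tuple_functional_norm_le. Qed.

Lemma W_tuple_dense (w : W Phi) (e : R) : 0 < e -> exists phi, `|w - W_tuple phi| < e.
Proof.
move=> e0; case: w => w wP; have : closure (lin_span (tuple_functionals Phi)) w.
  by move: wP; rewrite inE.
move=> /(_ _ (nbhsx_ballx w e e0)) [x [/lin_span_tuple[phi ->]]].
by rewrite -ball_normE /= => h; exists phi.
Qed.
End DenseSubset.
End TupleFunctionals.

(** * Boundary layers *)

Section BoundaryBumps.
Context (R : realType) (d : nat) (i0 : 'I_d).
Local Notation E := 'rV[R]_d.
Local Notation mu := (lebesgue_rV R d).
Local Notation cube := (cube R d).
Local Notation e_ i := (delta_mx 0 i : E).

Lemma flat_gt0 n (x : R) : 0 < x -> 0 < flat n x.
Proof. by move=> x0; rewrite /flat x0 mulr_gt0 ?expR_gt0// exprn_gt0// invr_gt0. Qed.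

Lemma flat_neq0 n (x : R) : flat n x != 0 -> 0 < x.
Proof. by apply: contraNT; rewrite -leNgt => /flat_neg ->. Qed.

Lemma flat0_ltr (x y : R) : x < y -> 0 < y -> flat 0 x < flat 0 y.
Proof.
move=> xy y0; have [x0|x0] := leP x 0; first by rewrite (flat_neg _ x0) flat_gt0.
by rewrite /flat x0 y0 !expr0 !mul1r ltr_expR ltrN2 ltf_pV2.
Qed.

Lemma test_function_box (h : E -> R^o) (lo hi : 'I_d -> R) : smooth h ->
  (forall j, 0 < lo j) -> (forall j, hi j < 1) ->
  (forall x, h x != 0 -> forall j, lo j <= x 0 j <= hi j) -> test_function h.
Proof.
move=> sh lo0 hi1 hbox.
apply: (test_function_sub (K := [set x : E | forall j, `[lo j, hi j]%classic (x 0 j)])) => //.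
- by apply: (@rV_compact R d (fun j => `[lo j, hi j]%classic)) => j; exact: segment_compact.
- move=> x xb; rewrite /interior /=.
  apply: (@filter_forall _ _ (fun j => [set y : E | 0 <= y 0 j <= 1]) (nbhs x)) => j.
  have := xb j; rewrite /= in_itv/= => /andP[x1 x2].
  have : nbhs (x 0 j) [set r : R | 0 <= r <= 1].
    have x0 : 0 < x 0 j < 1 by rewrite (lt_le_trans (lo0 j))//= (le_lt_trans x2).
    have : x 0 j \in `]0, 1[ by rewrite in_itv.
    move=> /near_in_itvoo; apply: filterS => r; rewrite in_itv/=.
    by move=> /andP[/ltW -> /ltW ->].
  exact: (@coord_continuous R 1 d 0 j x).
Qed.

(** A cut-off in the directions tangent to the face x_i0 = 0, needed for compact
    support in the open cube. *)
Definition transversal (x : E) : R :=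
  \prod_(j < d | j != i0) (flat 0 (x 0 j - 4^-1) * flat 0 (3 / 4 - x 0 j)).

Lemma smooth_prod (s : seq 'I_d) (P : pred 'I_d) (f : 'I_d -> E -> R^o) :
  (forall j, smooth (f j)) -> smooth ((fun x => \prod_(j <- s | P j) f j x) : E -> R^o).
Proof.
move=> sf; elim: s => [|j s IH].
  rewrite (_ : (fun x => _) = (fun=> 1)); first exact: smooth_cst.
  by apply/funext => x; rewrite big_nil.
rewrite (_ : (fun x => _) = (fun x => (if P j then f j x else 1) * \prod_(j <- s | P j) f j x)).
  by apply: smoothM IH; case: (P j) => //; exact: smooth_cst.
by apply/funext => x; rewrite big_cons; case: (P j); rewrite ?mul1r.
Qed.

Lemma smooth_transversal : smooth (transversal : E -> R^o).
Proof.
apply: smooth_prod => j; apply: smoothM.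
  by apply: smooth_flat_comp; apply: smoothD; [exact: smooth_coord|exact: smooth_cst].
apply: smooth_flat_comp; apply: smoothD; first exact: smooth_cst.
rewrite (_ : (fun x => _) = (fun x : E => -1 * x 0 j)).
  by apply: smoothZ; exact: smooth_coord.
by apply/funext => x; rewrite mulN1r.
Qed.

Lemma transversal_itv x : 0 <= transversal x <= 1.
Proof.
apply/andP; split; first by rewrite prodr_ge0// => j _; rewrite mulr_ge0 ?flat_ge0.
by apply: prodr_ile1 => j _; rewrite mulr_ge0 ?flat_ge0//= mulr_ile1 ?flat_ge0 ?flat0_le1.
Qed.

Lemma transversal_support x : transversal x != 0 ->
  forall j, j != i0 -> 4^-1 <= x 0 j <= 3 / 4.
Proof.
move=> /prodf_neq0 h j ji; have := h j ji; rewrite mulf_eq0 negb_or.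
by move=> /andP[/flat_neq0 h1 /flat_neq0 h2]; lra.
Qed.

Lemma is_derive_transversal x : is_derive x (e_ i0) (transversal : E -> R^o) 0.
Proof.
have -> : x = x + 0 *: e_ i0 by rewrite scale0r addr0.
apply: is_derive_of_line.
rewrite (_ : (fun r : R => _) = cst (transversal x)); first exact: is_derive_cst.
apply/funext => r /=; apply: eq_bigr => j ji.
by rewrite !mxE eqxx/= (negbTE ji) mulr0 addr0.
Qed.

Let K : R := (flat 0 1)^-1.

Let K0 : 0 < K. Proof. by rewrite invr_gt0 flat_gt0. Qed.

Section Scale.
Variable c : R.

(** Rescales the layer 1/(2c) < x_i0 < 1/c to the interval (0, 1). *)
Definition depth (x : E) : R := 2 * c * x 0 i0 - 1.
(** Chosen so that [flat 0] of it vanishes for depth at most 0 and is constant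
    from depth 1 on: a smooth step obtained from [flat 0] by composition. *)
Definition ramp (x : E) : R := 1 - K * flat 0 (1 - depth x).
(** A smooth step across the layer, and its derivative.  The step itself is not
    compactly supported in the open cube, but its derivative is, and so is the
    difference of two steps. *)
Definition front (x : E) : R := transversal x * flat 0 (ramp x).
Definition peak (x : E) : R :=
  transversal x * (flat 2 (ramp x) * (K * (flat 2 (1 - depth x) * (2 * c)))).

Lemma is_derive_depth x : is_derive x (e_ i0) ((fun y => 1 - depth y) : E -> R^o) (- (2 * c)).
Proof.
have h : is_derive x (e_ i0) ((cst 2 : E -> R^o) - (2 * c) \*: ((fun y : E => y 0 i0) : E -> R^o))
    (0 - (2 * c) *: (i0 == i0)%:R).
  apply: is_deriveB; apply: is_deriveZ; exact: is_derive_coord.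
rewrite (_ : (fun y => _) = ((cst 2 : E -> R^o) - (2 * c) \*: ((fun y : E => y 0 i0) : E -> R^o))).
  by apply: is_derive_eq h _; rewrite sub0r eqxx [_ *: _]mulr1.
by apply/funext => y; rewrite /depth -[RHS]/(2 - 2 * c * y 0 i0); lra.
Qed.

Lemma smooth_depth : smooth ((fun y => 1 - depth y) : E -> R^o).
Proof.
rewrite (_ : (fun y => _) = (fun y : E => - (2 * c) * y 0 i0 + 2)).
  by apply: smoothD; [apply: smoothZ; exact: smooth_coord|exact: smooth_cst].
by apply/funext => y; rewrite /depth; lra.
Qed.

Lemma flat'0 (x : R) : flat' 0 x = flat 2 x.
Proof. by rewrite /flat' mul0r subr0. Qed.

Lemma smooth_ramp : smooth (ramp : E -> R^o).
Proof.
rewrite (_ : ramp = (fun x => - K * flat 0 (1 - depth x) + 1)).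
  by apply: smoothD; [apply: smoothZ; apply: smooth_flat_comp; exact: smooth_depth|exact: smooth_cst].
by apply/funext => y; rewrite /ramp; lra.
Qed.

Lemma is_derive_ramp x :
  is_derive x (e_ i0) (ramp : E -> R^o) (K * (flat 2 (1 - depth x) * (2 * c))).
Proof.
have h1 : is_derive x (e_ i0) ((fun y => flat 0 (1 - depth y)) : E -> R^o)
    (flat' 0 (1 - depth x) * - (2 * c)).
  by apply: is_derive_comp_line; [exact: is_derive_flat|exact: is_derive_depth].
have h2 : is_derive x (e_ i0) ((cst 1 : E -> R^o) - K \*: ((fun y => flat 0 (1 - depth y)) : E -> R^o))
   (0 - K *: (flat' 0 (1 - depth x) * - (2 * c))).
  by apply: is_deriveB; apply: is_deriveZ.
apply: is_derive_eq h2 _.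
by rewrite flat'0 -[K *: _]/(K * _); ring.
Qed.

Lemma smooth_front : smooth (front : E -> R^o).
Proof.
by apply: smoothM; [exact: smooth_transversal|apply: smooth_flat_comp; exact: smooth_ramp].
Qed.

Lemma is_derive_front x : is_derive x (e_ i0) (front : E -> R^o) (peak x).
Proof.
have h : is_derive x (e_ i0) ((fun y => flat 0 (ramp y)) : E -> R^o)
    (flat' 0 (ramp x) * (K * (flat 2 (1 - depth x) * (2 * c)))).
  by apply: is_derive_comp_line; [exact: is_derive_flat|exact: is_derive_ramp].
have h2 := @is_deriveM _ _ (transversal : E -> R^o) _ x (e_ i0) _ _ (is_derive_transversal x) h.
apply: is_derive_eq h2 _.
by rewrite flat'0 scaler0 addr0.
Qed.

Lemma partial_front : partial i0 front = peak.
Proof. by apply: is_derive_partial; exact: is_derive_front. Qed.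

Lemma ramp_gt0 x : (0 < ramp x) = (0 < depth x).
Proof.
rewrite /ramp subr_gt0 -ltr_pdivlMl// invrK mulr1.
have [h|h] := ltP 0 (depth x).
  by apply: flat0_ltr => //; rewrite ltrBlDr ltrDl.
apply/negbTE; rewrite -leNgt.
have [->|/eqP h0] := eqVneq (depth x) 0; first by rewrite subr0.
apply/ltW/flat0_ltr; last by rewrite subr_gt0 (le_lt_trans h).
by rewrite ltrDl oppr_gt0 lt_neqAle h andbT; apply/eqP.
Qed.

Lemma ramp_full x : 1 <= depth x -> ramp x = 1.
Proof. by move=> h; rewrite /ramp flat_neg ?mulr0 ?subr0// subr_le0. Qed.

Lemma front_itv x : 0 <= front x <= 1.
Proof.
have /andP[t0 t1] := transversal_itv x.
by rewrite /front mulr_ge0 ?flat_ge0//= mulr_ile1 ?flat_ge0 ?flat0_le1.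
Qed.

Hypothesis c2 : 2 <= c.
Let c0 : 0 < c. Proof. by rewrite (lt_le_trans _ c2). Qed.

Lemma depth_gt0 x : 0 < depth x -> (2 * c)^-1 <= x 0 i0.
Proof.
rewrite /depth subr_gt0 => h; apply: ltW.
by rewrite -[_^-1]mul1r ltr_pdivrMr ?mulr_gt0// mulrC.
Qed.

Lemma depth_lt1 x : depth x < 1 -> x 0 i0 < c^-1.
Proof.
rewrite /depth ltrBlDr -(mulr1n 1) -mulrSr => h.
rewrite -[ltRHS]mul1r ltr_pdivlMr//; lra.
Qed.

Lemma peak_ge0 x : 0 <= peak x.
Proof.
have /andP[t0 _] := transversal_itv x.
by rewrite /peak !mulr_ge0 ?flat_ge0// ltW.
Qed.

Lemma peak_support x : peak x != 0 -> transversal x != 0 /\ 0 < depth x < 1.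
Proof.
rewrite /peak !mulf_eq0 !negb_or => /andP[-> /andP[/flat_neq0 + /andP[_ /andP[/flat_neq0 + _]]]].
by rewrite ramp_gt0 => -> /=; rewrite subr_gt0.
Qed.

Let lo (a : R) (j : 'I_d) : R := if j == i0 then a else 4^-1.
Let hi (a : R) (j : 'I_d) : R := if j == i0 then a else 3 / 4.

Lemma test_function_peak : test_function (peak : E -> R^o).
Proof.
apply: (@test_function_box _ (lo (2 * c)^-1) (hi c^-1)).
- rewrite -partial_front; apply: smooth_partial; exact: smooth_front.
- by move=> j; rewrite /lo; case: ifP => _; rewrite invr_gt0// mulr_gt0.
- move=> j; rewrite /hi; case: ifP => _; last lra.
  by rewrite invf_lt1// (lt_le_trans _ c2)// ltr1n.
- move=> x /peak_support[tx /andP[d0 d1]] j; rewrite /lo /hi; case: eqP => [->|/eqP ji].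
    by rewrite depth_gt0//= ltW// depth_lt1.
  exact: transversal_support.
Qed.

Definition peak_testfun : testfun R d := exist _ _ test_function_peak.

Lemma peak_lt x : peak x != 0 -> x 0 i0 < c^-1.
Proof. by move=> /peak_support[_ /andP[_ /depth_lt1]]. Qed.
End Scale.

Section TwoScales.
Variables (c c' : R) (c2 : 2 <= c) (cc' : c <= c').
Let c0 : 0 < c. Proof. by rewrite (lt_le_trans _ c2). Qed.
Let c'0 : 0 < c'. Proof. by rewrite (lt_le_trans _ cc'). Qed.
Let c'2 : 2 <= c'. Proof. exact: le_trans cc'. Qed.

Lemma front_sub_support x : front c' x - front c x != 0 ->
  transversal x != 0 /\ 0 < depth c' x /\ depth c x < 1.
Proof.
move=> h; have tx : transversal x != 0.
  apply/eqP => t0; move: h; rewrite /front t0 (mul0r (flat 0 (ramp c' x))).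
  by rewrite (mul0r (flat 0 (ramp c x))) subrr eqxx.
split=> //; have cc'x : 0 < depth c x -> depth c x <= depth c' x.
  move=> /(depth_gt0 c2) h0; rewrite /depth lerB// ler_wpM2r// ?ler_wpM2l//.
  by apply: le_trans h0; rewrite invr_ge0 mulr_ge0// ltW.
split.
  rewrite ltNge; apply: contraNN h => h'; rewrite /front.
  rewrite !flat_neg ?mulr0 ?subrr// leNgt ramp_gt0 -leNgt//.
  rewrite leNgt; apply/negP => h0.
  by have := cc'x h0; rewrite leNgt (le_lt_trans h' h0).
rewrite ltNge; apply: contraNN h => h'.
rewrite /front (ramp_full h') ramp_full ?subrr//.
by rewrite (le_trans h')// cc'x// (lt_le_trans _ h').
Qed.

Lemma test_function_front_sub : test_function ((fun x => -1 * front c x + front c' x) : E -> R^o).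
Proof.
apply: (@test_function_box _ (fun j => if j == i0 then (2 * c')^-1 else 4^-1)
  (fun j => if j == i0 then c^-1 else 3 / 4)).
- by apply: smoothD; [apply: smoothZ|]; exact: smooth_front.
- by move=> j; case: ifP => _; rewrite invr_gt0// mulr_gt0.
- move=> j; case: ifP => _; last lra.
  by rewrite invf_lt1// (lt_le_trans _ c2)// ltr1n.
- move=> x; rewrite mulN1r addrC => /front_sub_support[tx [d0 d1]] j; case: eqP => [->|/eqP ji].
    by rewrite (depth_gt0 c'2)//= ltW// depth_lt1.
  exact: transversal_support.
Qed.

Definition front_sub : testfun R d := exist _ _ test_function_front_sub.

Lemma front_sub_le1 x : `|front_sub x| <= 1.
Proof.
rewrite -[X in `|X|]/(-1 * front c x + front c' x).
have /andP[f0 f1] := front_itv c x; have /andP[g0 g1] := front_itv c' x.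
by rewrite ler_norml; apply/andP; split; lra.
Qed.

Lemma front_sub_lt x : front_sub x != 0 -> x 0 i0 < c^-1.
Proof.
rewrite -[front_sub x]/(-1 * front c x + front c' x) mulN1r addrC.
by move=> /front_sub_support[_ [_ /(depth_lt1 c2)]].
Qed.

Lemma partial_front_sub :
  partial i0 front_sub = (fun x => -1 * peak_testfun c2 x + peak_testfun c'2 x).
Proof.
apply: is_derive_partial => x.
have h1 := is_deriveZ (-1) (is_derive_front c x).
have h := is_deriveD h1 (is_derive_front c' x).
exact: h.
Qed.
End TwoScales.
End BoundaryBumps.

(** * The mass of the layers *)

Section PeakIntegrals.
Context (R : realType) (d : nat) (i0 : 'I_d).
Local Notation E := 'rV[R]_d.
Local Notation mu := (lebesgue_rV R d).
Local Notation cube := (cube R d).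

Lemma Rintegral_testfun_half_space (f : testfun R d) c :
  (forall x : E, f x != 0 -> x 0 i0 < c) ->
  \int[mu]_(x in half_space i0 c) f x = \int[mu]_x f x.
Proof.
move=> fc; rewrite Rintegral_mkcond; apply: eq_Rintegral => x _.
rewrite patchE; case: ifPn => // /negP hx; apply/esym/eqP/negP => /negP /fc h.
by apply: hx; rewrite inE.
Qed.

Lemma pairing_strip_eq0 (f : testfun R d) c : (forall x : E, x 0 i0 < c -> f x = 0) ->
  pairing (strip_L1 i0 c) f = 0.
Proof.
move=> fc; rewrite pairing_strip (eq_Rintegral (g := cst 0) _); last first.
  by move=> x /set_mem; exact: fc.
by rewrite Rintegral_cst ?mul0r//; exact: half_space_measurable.
Qed.

(** Two peaks differ by the partial derivative of a test function, the
    difference of the steps. *)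
Lemma integral_peak_eq (c c' : R) (c2 : 2 <= c) (c'2 : 2 <= c') :
  \int[mu]_x peak_testfun i0 c2 x = \int[mu]_x peak_testfun i0 c'2 x.
Proof.
wlog cc' : c c' c2 c'2 / c <= c'.
  move=> wl; have [cc'|/ltW c'c] := leP c c'; first exact: wl.
  by apply/esym; exact: wl.
have := integral_partial_setT (front_sub i0 c2 cc') i0.
rewrite partial_front_sub.
have i1 := testfun_integrable (peak_testfun i0 c2) measurableT.
have i2 := testfun_integrable (peak_testfun i0 (le_trans c2 cc')) measurableT.
under eq_Rintegral do rewrite mulN1r addrC.
rewrite RintegralB// => /eqP; rewrite subr_eq0 => /eqP <-.
by apply: eq_Rintegral.
Qed.

Definition peak_mass : R := \int[mu]_x peak_testfun i0 (lexx (2 : R)) x.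

Lemma peak_mass_gt0 : 0 < peak_mass.
Proof.
set f := peak_testfun i0 (lexx (2 : R)).
(* The centre of the cube in the tangential directions, at depth 1/2. *)
pose x0 : E := \row_j if j == i0 then 3 / 8 else 2^-1.
have fx0 : 0 < f x0.
  have dx0 : depth i0 2 x0 = 2^-1 by rewrite /depth mxE eqxx; lra.
  rewrite -[f x0]/(peak i0 2 x0) /peak dx0 mulr_gt0//.
    apply: prodr_gt0 => j ji; rewrite mxE (negbTE ji).
    by rewrite mulr_gt0// flat_gt0//; lra.
  have r0 : 0 < ramp i0 2 x0 by rewrite ramp_gt0 dx0; lra.
  rewrite mulr_gt0 ?flat_gt0// mulr_gt0//; first by rewrite invr_gt0 flat_gt0.
  by rewrite mulr_gt0 ?flat_gt0//; lra.
have : nbhs x0 [set x | f x0 / 2 < f x].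
  have cf := @testfun_continuous _ _ f x0.
  apply: (cf [set r : R | f x0 / 2 < r]); have : f x0 \in `]f x0 / 2, f x0 + 1[.
    by rewrite in_itv/= ltrDl ltr01 ltr_pdivrMr// ltr_pMr// ltr1n.
  by move=> /near_in_itvoo; apply: filterS => r; rewrite in_itv/= => /andP[].
move=> /nbhs_ballP[e /= e0 eB].
pose A (j : 'I_d) : set R := `]x0 0 j - e, x0 0 j + e[%classic.
pose B : set E := [set x | forall j, A j (x 0 j)].
have mB : measurable B by apply: box_measurable => j; exact: measurable_itv.
have muB : mu B = ((e + e) ^+ d)%:E.
  rewrite lebesgue_rV_box; last by move=> j; exact: measurable_itv.
  rewrite (eq_bigr (fun=> (e + e)%:E)); last first.
    move=> j _; rewrite lebesgue_measure_itv/= lte_fin ifT -?EFinB; last lra.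
    by congr EFin; lra.
  by rewrite -(big_morph EFin (@EFinM R) erefl) prodr_const card_ord.
have fB x : B x -> f x0 / 2 <= f x.
  move=> Bx; apply/ltW/eB; apply/ball_rVP => // j.
  have := Bx j; rewrite /A /= in_itv/= => /andP[h1 h2].
  by rewrite ltr_norml; apply/andP; split; lra.
have fint := testfun_integrable f measurableT.
have fintB := testfun_integrable f mB.
apply: (@lt_le_trans _ _ (\int[mu]_(x in B) cst (f x0 / 2) x)).
  rewrite Rintegral_cst// [X in fine X]muB mulr_gt0// ?exprn_gt0 ?addr_gt0//.
  by rewrite divr_gt0.
apply: (@le_trans _ _ (\int[mu]_(x in B) f x)).
  apply: le_Rintegral => //.
  apply: measurable_bounded_integrable => //; first by rewrite [ltLHS]muB ltry.
  exists (f x0 / 2); split; first exact: num_real.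
  by move=> N NK x _ /=; rewrite ger0_norm ?ltW// divr_gt0.
rewrite /peak_mass -/f /Rintegral fine_le//.
- exact: integrable_fin_num.
- exact: integrable_fin_num.
- apply: ge0_subset_integral => //; first by case/integrableP : fint.
  by move=> x _; rewrite lee_fin; exact: peak_ge0.
Qed.

Lemma pairing_strip_peak (c t : R) (c2 : 2 <= c) : c^-1 <= t ->
  pairing (strip_L1 i0 t) (peak_testfun i0 c2) = peak_mass.
Proof.
move=> ct; rewrite pairing_strip Rintegral_testfun_half_space; first exact: integral_peak_eq.
by move=> x /(peak_lt c2) /lt_le_trans; apply.
Qed.
End PeakIntegrals.

(** * Homotheties close to the identity *)

Section DilationLimit.
Context (R : realType) (d : nat).
Local Notation E := 'rV[R]_d.
Local Notation cube := (cube R d).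

(** Joint continuity at ratio 1, made uniform by compactness of the cube. *)
Lemma dilation_near (f : testfun R d) (k : R -> R) (e : R) : k s @[s --> (1 : R)] --> (1 : R) ->
  0 < e -> \forall s \near (1 : R), forall x, cube x -> `|k s * f (stretch s x) - f x| < e.
Proof.
move=> ck e0.
have /compact_near_coveringP cc := @cube_compact R d.
apply: (cc R (nbhs (1 : R)) (fun s x => `|k s * f (stretch s x) - f x| < e)) => x cx.
have s1 : p.2 @[p --> (x, 1 : R)] --> (1 : R) by exact: cvg_snd.
have sx : p.1 @[p --> (x, 1 : R)] --> x by exact: cvg_fst.
have sV : (p.2)^-1 @[p --> (x, 1 : R)] --> (1 : R).
  by rewrite -[X in _ --> X]invr1; apply: cvgV => //; rewrite oner_neq0.
have sa : - (1 - p.2) / p.2 @[p --> (x, 1 : R)] --> (0 : R).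
  rewrite -[X in _ --> X](mulr1 (0 : R)) -[in X in _ --> X](@oppr0 R) -(subrr (1 : R)).
  by apply: cvgM => //; apply: cvgN; apply: cvgB => //; exact: cvg_cst.
have cS : stretch p.2 p.1 @[p --> (x, 1 : R)] --> x.
  rewrite (_ : (fun p => _) = (fun p : E * R => (- (1 - p.2) / p.2) *: const_mx 1 + (p.2)^-1 *: p.1)).
    rewrite -[X in _ --> X]add0r -(scale0r (const_mx 1 : E)) -[X in _ + X]scale1r.
    apply: cvgD; first by apply: cvgZr_tmp.
    by apply: cvgZ.
  by apply/funext => p; apply/rowP => j; rewrite /stretch /affine_map !mxE mulr1.
have cf : k p.2 * f (stretch p.2 p.1) - f p.1 @[p --> (x, 1 : R)] --> (0 : R).
  rewrite -[X in _ --> X](subrr (f x)) -{1}[f x]mul1r; apply: cvgB.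
    apply: cvgM; first exact: (cvg_comp _ _ s1 ck).
    exact: (cvg_comp _ _ cS (@testfun_continuous _ _ f x)).
  exact: (cvg_comp _ _ sx (@testfun_continuous _ _ f x)).
have /cvgr0Pnorm_lt /(_ e e0) := cf.
exact.
Qed.

Lemma exprVn_cvg1 n : (s^-1 ^+ n) @[s --> (1 : R)] --> (1 : R).
Proof.
have h : s^-1 @[s --> (1 : R)] --> (1 : R).
  by rewrite -[X in _ --> X]invr1; apply: cvgV; rewrite ?oner_neq0//; exact: cvg_id.
elim: n => [|n IH]; first exact: cvg_cst.
have e : (fun s : R => s^-1 ^+ n.+1) = (fun s : R => s^-1 * s^-1 ^+ n).
  by apply/funext => s; rewrite exprS.
by rewrite e; have := cvgM h IH; rewrite mulr1; exact.
Qed.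

Lemma dilate_tuple_near (phi : 'I_d.+1 -> testfun R d) (e : R) : 0 < e ->
  exists s : R, exists s0 : 0 < s, exists s1 : s <= 1,
  [/\ s < 1, s^-1 ^+ d < 1 + e &
    forall j x, `|comb_testfun (-1) (dilate_tuple s0 s1 phi j) (phi j) x| <= e].
Proof.
move=> e0.
pose k (j : 'I_d.+1) (s : R) : R := if j == ord0 then s^-1 ^+ d else s^-1 ^+ d * s.
have ck j : k j s @[s --> (1 : R)] --> (1 : R).
  rewrite /k; case: (j == ord0); first exact: exprVn_cvg1.
  by have := cvgM (@exprVn_cvg1 d) (@cvg_id _ (nbhs (1 : R))); rewrite mulr1; exact.
have : \forall s \near (1 : R), [/\ 0 < s, s^-1 ^+ d < 1 + e & forall j x, cube x ->
    `|k j s * phi j (stretch s x) - phi j x| < e].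
  near=> s; split.
  - by near: s; exact: lt_nbhsr.
  - near: s; apply: (cvgr_lt _ (@exprVn_cvg1 d)).
    by rewrite ltrDl.
  - near: s; apply: filter_forall => j; exact: dilation_near.
move=> /nbhs_ballP[r /= r0 rP].
pose s : R := 1 - r / 2.
have s1 : s < 1 by rewrite /s ltrBlDr ltrDl divr_gt0.
have [|s0 sd sk] := rP s.
  rewrite /ball /= ger0_norm; last by rewrite subr_ge0 ltW.
  by rewrite /s opprB addrC subrK ltr_pdivrMr// ltr_pMr// ltr1n.
exists s, s0, (ltW s1); split => // j x.
rewrite -[X in `|X|]/(-1 * (k j s * phi j (stretch s x)) + phi j x).
rewrite mulN1r -normrN opprD opprK.
have [cx|ncx] := pselect (cube x); first by apply: ltW; exact: sk.
rewrite !testfun_out ?mulr0 ?subrr ?normr0 ?ltW//.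
by move=> /(shrink_cube s0 (ltW s1)); rewrite stretchK.
Unshelve. all: by end_near.
Qed.
End DilationLimit.

(** * Weak star limits, and the predual inside its bidual *)

Section WeakCluster.
Context (R : realType) (Y : normedModType R).

(** The Banach-Alaoglu theorem for a bounded sequence, with weak star limits
    taken along an ultrafilter. *)
Lemma weak_cluster (eta : nat -> Y) (M : R) : (forall n, `|eta n| <= M) ->
  exists2 U : set_system nat, ProperFilter U /\ \oo `<=` U &
  exists xi : dual (dual Y), forall f : dual Y, f (eta n) @[n --> U] --> (xi f : R).
Proof.
move=> etaM; have [U [UU sU]] := @ultraFilterLemma nat \oo _.
have PU : ProperFilter U by apply: ultra_proper.
have M0 : 0 <= M by exact: le_trans (etaM 0%N).
exists U; first by [].
have lim (f : dual Y) : exists l : R, f (eta n) @[n --> U] --> l.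
  pose C := `|f| * M.
  have fC n : `|dual_fun f (eta n)| <= C.
    by apply: le_trans (dual_norm_ub f _) _; rewrite ler_wpM2l//; exact: dual_norm_ge0.
  have [] := @segment_compact R (- C) C (dual_fun f (eta n) @[n --> U]).
    apply: (@filterE _ U) => n; rewrite /preimage/= in_itv/= -ler_norml.
    exact: fC.
  move=> p [_ clp]; exists p => B Bp.
  have [//|UnB] := in_ultra_setVsetC ((fun n => dual_fun f (eta n)) @^-1` B) UU.
  by have [x [nBx Bx]] := clp (~` B) B UnB Bp.
have [xi xiP] := choice lim.
have xi_unique (f : dual Y) (r : R) : f (eta n) @[n --> U] --> r -> xi f = r.
  by move=> fr; rewrite -(cvg_lim (@Rhausdorff R) fr) (cvg_lim (@Rhausdorff R) (xiP f)).
have xil : linear (xi : dual Y -> R^o).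
  move=> a f g; apply: xi_unique.
  rewrite (_ : (fun n => dual_fun (a *: f + g) (eta n)) =
    (fun n => a * dual_fun f (eta n) + dual_fun g (eta n))); last first.
    by apply/funext => n; rewrite dual_funP.
  by apply: cvgD; [apply: cvgM; [exact: cvg_cst|exact: xiP]|exact: xiP].
have xib : exists C, forall f : dual Y, `|xi f : R^o| <= C * `|f|.
  exists M => f; apply: (@closed_cvg _ _ _ _ _ (fun r : R => `|r| <= M * `|f|) _ _ _ (xiP f)).
    by apply: (@closed_comp _ _ (fun r : R => `|r|) [set r | r <= M * `|f|]);
      [move=> r _; exact: norm_continuous|exact: closed_le].
  apply: filterE => n; rewrite mulrC (le_trans (dual_norm_ub f _))// ler_wpM2l//.
  exact: dual_norm_ge0.
by exists (mk_dual xil xib).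
Qed.
End WeakCluster.

Section Evaluation.
Context (R : realType) (d : nat) (Phi : set (testfun R d)).

Lemma eval_BV_linear (u : BV R d) : linear (fun w : W Phi => dual_fun (val w) u : R^o).
Proof. by move=> a v w; rewrite val_subsp_linear dual_funP. Qed.

Lemma eval_BV_bounded (u : BV R d) :
  exists C, forall w : W Phi, `|dual_fun (val w) u : R^o| <= C * `|w|.
Proof. by exists `|u| => w; rewrite mulrC; exact: (dual_norm_ub (val w)). Qed.

(** Functions of bounded variation acting on the predual. *)
Definition eval_BV (u : BV R d) : dual (W Phi) := mk_dual (eval_BV_linear u) (eval_BV_bounded u).

Lemma eval_BVE u w : eval_BV u w = dual_fun (val w) u.
Proof. by []. Qed.

Lemma eval_BV_le u : `|eval_BV u| <= `|u|.
Proof.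
by apply: dual_norm_le => // w; rewrite mulrC; exact: (dual_norm_ub (val w) u).
Qed.

Lemma eval_BV_comb a u v : eval_BV (a *: u + v) = a *: eval_BV u + eval_BV v.
Proof. by apply: dual_comb_ext => w; rewrite !eval_BVE dualD dualZ. Qed.

Lemma bidual_embed_sub (Y : normedModType R) (x y : Y) :
  bidual_embed (x - y) = bidual_embed x - bidual_embed y.
Proof.
apply: dual_ext => f; rewrite -[LHS]/(dual_fun f _) -[RHS]/(dual_fun f x - dual_fun f y).
by rewrite -scaleN1r dualD dualZ mulN1r.
Qed.

(** A limit [p] of embedded elements is the embedding of u |-> p (eval_BV u),
    which lies in the closed span because the distances to the approximants
    in the dual of BV are at most those in the bidual. *)
Lemma W_embed_closed : closed (range (@bidual_embed R (W Phi))).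
Proof.
move=> p clp.
have near_p (e : R) : 0 < e -> exists y : W Phi, `|p - bidual_embed y| < e.
  move=> e0; have [_ [[y _ <-]]] := clp _ (nbhsx_ballx p e e0).
  by rewrite -ball_normE /= => h; exists y.
have xl : linear (fun u : BV R d => dual_fun p (eval_BV u) : R^o).
  by move=> a u v; rewrite eval_BV_comb dualD dualZ.
have xb : exists C, forall u : BV R d, `|dual_fun p (eval_BV u) : R^o| <= C * `|u|.
  exists `|p| => u; rewrite (le_trans (dual_norm_ub p _))// ler_wpM2l ?eval_BV_le//.
  exact: dual_norm_ge0.
pose x : dual (BV R d) := mk_dual xl xb.
have xy (y : W Phi) : `|x - val y| <= `|p - bidual_embed y|.
  apply: dual_norm_le => // u; rewrite -[x - _]addrC -scaleN1r dual_funP mulN1r addrC.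
  have -> : dual_fun x u - dual_fun (val y) u = dual_fun (p - bidual_embed y) (eval_BV u) by [].
  rewrite (le_trans (dual_norm_ub _ _))// ler_wpM2l ?eval_BV_le//; exact: dual_norm_ge0.
have xW : x \in closed_span (tuple_functionals Phi).
  rewrite inE; apply: (@closed_closure _ (lin_span (tuple_functionals Phi))).
  move=> B /nbhs_ballP[e /= e0 eB]; have [y py] := near_p e e0.
  exists (val y); split; first by have := valP y; rewrite inE.
  by apply: eB; rewrite -ball_normE /=; exact: le_lt_trans (xy y) py.
pose w : W Phi := exist (fun x => x \in closed_span (tuple_functionals Phi)) x xW.
exists w => //; apply/eqP; rewrite -subr_eq0 -normr_le0; apply/ler_addgt0Pr => e e0; rewrite add0r.
have [y py] := near_p (e / 2) (divr_gt0 e0 (ltr0n _ 2)).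
have -> : bidual_embed w - p = bidual_embed (w - y) - (p - bidual_embed y).
  by rewrite bidual_embed_sub opprB addrA subrK.
rewrite (le_trans (ler_normB _ _))// [leRHS]splitr lerD ?(ltW py)//.
rewrite (le_trans (bidual_embed_le _))// ltW// (le_lt_trans _ py)//.
exact: xy.
Qed.
End Evaluation.

(** * The perturbed predual of BV *)

Lemma dual_comb3 (R : realType) (X : normedModType R) (f : dual X) (x y z : X) (t : R) :
  f (x + t *: (y - z)) = f x + t * (f y - f z).
Proof. by rewrite dualD dualZ -scaleN1r dualD dualZ mulN1r. Qed.

Lemma ler_of_small (R : realFieldType) (a N C : R) : 0 <= C ->
  (forall e, 0 < e -> e <= 1 -> a <= N + e * C) -> a <= N.
Proof.
move=> C0 h; apply/ler_addgt0Pr => e e0.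
have C1 : 0 < C + 1 by rewrite ltr_wpDl.
pose r := Num.min 1 (e / (C + 1)).
have r0 : 0 < r by rewrite lt_min ltr01 divr_gt0.
apply: le_trans (h r r0 _) _; first by rewrite ge_min lexx.
rewrite lerD2l (@le_trans _ _ (e / (C + 1) * C))//.
  by rewrite ler_wpM2r// ge_min lexx orbT.
by rewrite -mulrA ler_piMr ?(ltW e0)// ler_pdivrMl// mulr1 lerDl.
Qed.

Section Main.
Context (R : realType) (d : nat) (i0 : 'I_d).
Variables (Phi : set (testfun R d)) (Phi_dense : sup_dense Phi).
Local Notation E := 'rV[R]_d.
Local Notation Wt := (W_tuple Phi_dense).

(** Starting at 2 keeps every layer 1/(2c) < x_i0 < 1/c inside the cube. *)
Definition sharpness (n : nat) : R := n.+2%:R.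

Lemma sharpness_ge2 n : 2 <= sharpness n.
Proof. by rewrite ler_nat. Qed.

Lemma sharpness_le n m : (n <= m)%N -> sharpness n <= sharpness m.
Proof. by move=> nm; rewrite ler_nat !ltnS. Qed.

Lemma sharpness_inv_near (t : R) : 0 < t -> \forall n \near \oo, (sharpness n)^-1 <= t.
Proof.
move=> t0; near=> n; rewrite invf_ple ?posrE ?ltr0n//.
have : t^-1 < n%:R by near: n; exact: nbhs_infty_gtr.
move=> /ltW /le_trans; apply; rewrite ler_nat; exact: leqW (leqnSn n).
Unshelve. all: by end_near.
Qed.

Definition layer n : testfun R d := peak_testfun i0 (sharpness_ge2 n).

Definition layer_tuple n (j : 'I_d.+1) : testfun R d :=
  if j == ord0 then layer n else scale_testfun 0 (layer n).

(** Functionals of densities of constant mass that concentrate on the face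
    x_i0 = 0. *)
Definition eta n : W Phi := Wt (layer_tuple n).

Lemma eval_eta u n : dual_fun (val (eta n)) u = pairing (val u) (layer n).
Proof.
rewrite -[LHS]/(dual_fun (tuple_functional (layer_tuple n)) u) tuple_functionalE.
have -> : divergence (fun i => layer_tuple n (lift ord0 i)) =
    divergence (fun i => scale_testfun 0 (layer n)) by [].
rewrite divergence_scale pairingZr; last exact: divergence_continuous.
by rewrite mul0r addr0.
Qed.

Lemma eq_sub (x x' y y' z : R) : x = x' -> y = y' -> z = -1 * y' + x' -> x - y = z.
Proof. by move=> -> -> ->; rewrite mulN1r addrC. Qed.

Lemma eta_sub u n m (nm : (n <= m)%N) :
  dual_fun (val (eta m)) u - dual_fun (val (eta n)) u =
  pairing (val u) (partial i0 (front_sub i0 (sharpness_ge2 n) (sharpness_le nm))).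
Proof.
apply: (eq_sub (eval_eta u m) (eval_eta u n)); rewrite partial_front_sub.
exact: (pairing_comb _ _ (@testfun_continuous _ _ (layer n)) (@testfun_continuous _ _ (layer m))).
Qed.

Lemma eta_sub_le (s : R) (s0 : 0 < s) (s1 : s <= 1) u n m : (n <= m)%N ->
  (sharpness n)^-1 <= 1 - s ->
  `|dilate_BV s0 s1 u| + `|dual_fun (val (eta m)) u - dual_fun (val (eta n)) u| <= s^-1 ^+ d * `|u|.
Proof.
move=> nm ns; rewrite (eta_sub u nm); apply: dilate_BV_norm_add => x.
  exact: front_sub_le1.
by move=> /front_sub_lt /lt_le_trans; apply.
Qed.

Lemma W_sub_eval (x y : W Phi) u :
  dual_fun (val (x - y)) u = dual_fun (val x) u - dual_fun (val y) u.
Proof.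
have := dualD (eval_BV Phi u) x (- y); rewrite -scaleN1r (dualZ (eval_BV Phi u)) mulN1r.
by rewrite scaleN1r (eval_BVE u (x - y)) (eval_BVE u x) (eval_BVE u y).
Qed.

Lemma W_tuple_dist phi psi (e : R) : 0 < e ->
  (forall j x, `|comb_testfun (-1) (psi j) (phi j) x| <= e) -> `|Wt phi - Wt psi| <= e.
Proof.
move=> e0 h; rewrite addrC -scaleN1r -W_tuple_comb.
exact: W_tuple_norm_le.
Qed.

Lemma W_comb_norm_le (x y z : W Phi) (t K : R) : 0 <= K -> `|t| <= 1 ->
  (forall u, `|dual_fun (val x) u| + `|dual_fun (val y) u - dual_fun (val z) u| <= K * `|u|) ->
  `|x + t *: (y - z)| <= K.
Proof.
move=> K0 t1 xyz; apply: dual_norm_le => // u; apply: le_trans (xyz u).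
have -> : dual_fun (val (x + t *: (y - z))) u =
    dual_fun (val x) u + t * (dual_fun (val y) u - dual_fun (val z) u).
  have := dual_comb3 (eval_BV Phi u) x y z t.
  by rewrite (eval_BVE u (x + t *: (y - z))) (eval_BVE u x) (eval_BVE u y) (eval_BVE u z).
by rewrite (le_trans (ler_normD _ _))// lerD2l normrM ler_piMl.
Qed.

(** The dilated tuple has norm at most s^-d, and a multiple of eta_m - eta_n
    leaves this bound intact, since the two act on disjoint regions. *)
Lemma dilated_layer_le phi (s : R) (s0 : 0 < s) (s1 : s <= 1) n m (t : R) : (n <= m)%N ->
  (sharpness n)^-1 <= 1 - s -> `|Wt phi| <= 1 -> `|t| <= 1 ->
  `|Wt (dilate_tuple s0 s1 phi) + t *: (eta m - eta n)| <= s^-1 ^+ d.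
Proof.
move=> nm ns phi1 t1; apply: W_comb_norm_le => //.
  by rewrite exprn_ge0// invr_ge0 ltW.
move=> u; apply: le_trans (eta_sub_le s0 s1 u nm ns).
rewrite lerD2r -[dual_fun _ u](tuple_pairing_dilate s0 s1 phi u).
rewrite (le_trans (dual_norm_ub (tuple_functional phi) _))// ler_piMl//; exact: phi1.
Qed.

Lemma eta_bounded : exists M, forall n, `|eta n| <= M.
Proof.
exists (`|eta 0| + 2 ^+ d) => n.
(* Layer 0 lies in x_i0 < 1/2, hence off the cube shrunk by 1/2. *)
have h0 : 0 < 2^-1 :> R by rewrite invr_gt0.
have h1 : 2^-1 <= 1 :> R by rewrite invf_le1// ler1n.
rewrite -[eta n](subrK (eta 0)) addrC (le_trans (ler_normD _ _))// lerD2l.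
apply: dual_norm_le; first by rewrite exprn_ge0.
move=> u; have := @eta_sub_le _ h0 h1 u 0 n (leq0n n) _; rewrite invrK => h.
apply: le_trans (h _); last first.
  by rewrite /sharpness; lra.
have -> : dual_fun (val (eta n - eta 0)) u = dual_fun (val (eta n)) u - dual_fun (val (eta 0)) u by [].
by rewrite lerDr.
Qed.

(** [strip i0 2] is 1 on the cube and has norm at most 2, so this functional has
    norm at most 1/2; hence |ell w| <= 1 for the elements of norm at most 2 met
    in [perturbed_norming_tuple]. *)
Definition ell : dual (W Phi) := 4^-1 *: eval_BV Phi (strip i0 2).

Lemma ell_eta n : ell (eta n) = 4^-1 * peak_mass R i0.
Proof.
rewrite -[LHS]/(4^-1 * dual_fun (eval_BV Phi (strip i0 2)) (eta n)) eval_BVE eval_eta.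
congr (_ * _); apply: pairing_strip_peak.
by rewrite invf_ple ?posrE ?ltr0n// (le_trans _ (sharpness_ge2 n))//; lra.
Qed.

Lemma ell_le : `|ell| <= 2^-1.
Proof.
rewrite normrZ gtr0_norm ?invr_gt0//.
have : `|eval_BV Phi (strip i0 2)| <= 2 by apply: le_trans (eval_BV_le _ _) (strip_norm _ _).
lra.
Qed.

Section Trace.
Variables (U : set_system nat) (PU : ProperFilter U) (sU : \oo `<=` U).
Variable xi : dual (dual (W Phi)).
Hypothesis xiP : forall f : dual (W Phi), f (eta n) @[n --> U] --> (xi f : R).

Lemma xi_eq (f : dual (W Phi)) (r : R) : (\forall n \near \oo, f (eta n) = r) -> xi f = r.
Proof.
move=> fr; have : f (eta n) @[n --> U] --> r.
  by apply: cvg_near_cst; apply: sU; apply: filterS fr => n /= ->.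
by move=> h; rewrite -(cvg_lim (@Rhausdorff R) (@xiP f)) (cvg_lim (@Rhausdorff R) h).
Qed.

Lemma xi_strip t : 0 < t -> xi (eval_BV Phi (strip i0 t)) = peak_mass R i0.
Proof.
move=> t0; apply: xi_eq; apply: filterS (sharpness_inv_near t0) => n nt.
by rewrite eval_BVE eval_eta; exact: pairing_strip_peak.
Qed.

Lemma xi_ell : xi ell = 4^-1 * peak_mass R i0.
Proof. by apply: xi_eq; apply: filterE => n; exact: ell_eta. Qed.

(** After dilation the tuple is supported in x_i0 >= 1 - s. *)
Lemma dilated_vanish phi (s : R) (s0 : 0 < s) (s1 : s <= 1) :
  dual_fun (tuple_functional (dilate_tuple s0 s1 phi)) (strip i0 (1 - s)) = 0.
Proof.
have out (f : testfun R d) (x : E) : x 0 i0 < 1 - s -> f (stretch s x) = 0.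
  move=> xs; apply: testfun_out => /(@stretch_cube _ _ _ s0 i0); apply/negP.
  by rewrite -ltNge.
rewrite tuple_functionalE pairing_strip_eq0 ?add0r; last first.
  by move=> x /out h; rewrite -[LHS]/(_ * phi ord0 (stretch s x)) h mulr0.
rewrite pairing_divergence big1// => i _.
rewrite -[partial i _]/(testfun_fun (partial_testfun i (dilate_tuple s0 s1 phi (lift ord0 i)))).
apply: pairing_strip_eq0 => x /out h.
rewrite -[LHS]/(partial i (scale_testfun (s^-1 ^+ d * s) (dilate_testfun s0 s1 (phi (lift ord0 i)))) x).
rewrite partial_scale -mulrA -partial_dilate.
by rewrite -[partial i _ _]/(partial_testfun i (phi (lift ord0 i)) (stretch s x)) h mulr0.
Qed.

(** Every element of the predual is close to a dilated tuple, which annihilates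
    a thin strip along the face, whereas [xi] takes the value [peak_mass] on
    all strips. *)
Lemma xi_not_embedded : ~ range (@bidual_embed R (W Phi)) xi.
Proof.
have too_small (m : R) : 0 < m -> m <= 2 * (m / 8) * 2 -> False by lra.
move=> [y _ yxi]; have m0 := peak_mass_gt0 R i0.
(* Two errors [e], tested on a strip of norm at most 2, make half the mass. *)
pose e := peak_mass R i0 / 8; have e0 : 0 < e by rewrite divr_gt0.
have [phi yphi] := W_tuple_dense Phi_dense y e0.
have [s [s0 [s1 [s1' _ sphi]]]] := dilate_tuple_near phi e0.
have t0 : 0 < 1 - s by rewrite subr_gt0.
have /esym := xi_strip t0; rewrite -yxi.
rewrite -[RHS]/(dual_fun (val y) (strip i0 (1 - s))) => yE.
have yd : `|y - Wt (dilate_tuple s0 s1 phi)| <= 2 * e.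
  rewrite (le_trans (ler_distD (Wt phi) _ _))// mulr_natl mulr2n.
  by apply: lerD; [exact: ltW|exact: W_tuple_dist].
have : `|dual_fun (val y) (strip i0 (1 - s))| <= 2 * e * 2.
  have -> : dual_fun (val y) (strip i0 (1 - s)) =
      dual_fun (val (y - Wt (dilate_tuple s0 s1 phi))) (strip i0 (1 - s)).
    rewrite W_sub_eval [X in _ = _ - X](_ : _ = 0) ?subr0//; exact: dilated_vanish.
  rewrite (le_trans (dual_norm_ub _ _))// ler_pM ?dual_norm_ge0 ?strip_norm//; exact: yd.
by rewrite -yE gtr0_norm//; exact: too_small.
Qed.

Lemma ell_neq0 : ell != 0.
Proof.
apply/eqP => l0; have := ell_eta 0; rewrite l0.
have -> : dual_fun (0 : dual (W Phi)) (eta 0) = 0 by [].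
by apply/eqP; rewrite lt_eqF// mulr_gt0 ?invr_gt0 ?peak_mass_gt0.
Qed.

(** The element is y_s + t (xi - eta_n), the weak star limit of
    y_s + t (eta_m - eta_n) as m grows. *)
Lemma perturbed_norm_le phi (s : R) (s0 : 0 < s) (s1 : s <= 1) n (t : R) :
  (sharpness n)^-1 <= 1 - s -> `|Wt phi| <= 1 -> `|t| <= 1 ->
  ell (Wt (dilate_tuple s0 s1 phi) + (- t) *: eta n) = t ->
  `|perturbed ell xi (Wt (dilate_tuple s0 s1 phi) + (- t) *: eta n)| <= s^-1 ^+ d.
Proof.
move=> ns phi1 t1; set w := Wt _; set y := w + _ => yt.
apply: dual_norm_le; first by rewrite exprn_ge0// invr_ge0 ltW.
move=> f; rewrite perturbedE yt.
have lim : dual_fun f (w + t *: (eta m - eta n)) @[m --> U] --> dual_fun f y + t * xi f.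
  rewrite (_ : (fun m => _) = (fun m => dual_fun f y + t * dual_fun f (eta m))).
    by apply: cvgD; [exact: cvg_cst|apply: cvgM; [exact: cvg_cst|exact: xiP]].
  apply/funext => m; rewrite (dual_comb3 f w (eta m) (eta n) t) /y dualD dualZ.
  by move: (dual_fun f w) (dual_fun f (eta m)) (dual_fun f (eta n)) => a b c; ring.
apply: (@closed_cvg _ _ _ _ _ (fun r : R => `|r| <= s^-1 ^+ d * `|f|) _ _ _ lim).
  by apply: (@closed_comp _ _ (fun r : R => `|r|) [set r | r <= s^-1 ^+ d * `|f|]);
    [move=> r _; exact: norm_continuous|exact: closed_le].
apply: sU; apply: filterS (nbhs_infty_ge n) => m nm.
rewrite (le_trans (dual_norm_ub f _))// mulrC ler_wpM2r ?dual_norm_ge0//.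
exact: dilated_layer_le.
Qed.

(** The perturbation of w - t eta_n, where w is a slight dilation of the given
    tuple, has norm about 1 and takes at [f] nearly the same value as the tuple. *)
Lemma perturbed_norming_tuple (f : dual (W Phi)) (N : R) : 0 <= N ->
  (forall y, `|perturbed ell xi y f| <= N * `|perturbed ell xi y|) ->
  forall phi, `|Wt phi| <= 1 -> `|f (Wt phi)| <= N.
Proof.
move=> N0 fN phi phi1.
apply: (@ler_of_small _ _ _ (`|f| + N + 1)) => [|e e0 e1].
  by rewrite !addr_ge0// dual_norm_ge0.
have [s [s0 [s1 [s1' sd sphi]]]] := dilate_tuple_near phi e0.
have wphi : `|Wt phi - Wt (dilate_tuple s0 s1 phi)| <= e by exact: W_tuple_dist.
have pert := @perturbed_norm_le phi s s0 s1.
move: wphi pert; set w := Wt (dilate_tuple s0 s1 phi) => wphi pert.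
have w2 : `|w| <= 2.
  have -> : w = Wt phi - (Wt phi - w) by rewrite opprB addrC subrK.
  rewrite (le_trans (ler_normB _ _))// -[leRHS]/(1 + 1) lerD//; exact: le_trans wphi e1.
have mass0 : 0 < 4^-1 * peak_mass R i0 by rewrite mulr_gt0 ?invr_gt0 ?peak_mass_gt0.
have := ell_eta; move: mass0; set q := _ * _ => q0 ellq.
(* The solution of ell (w - t eta_n) = t, as ell (eta_n) = q. *)
pose t := ell w / (1 + q).
have q1 : 0 < 1 + q by rewrite addr_gt0.
have t1 : `|t| <= 1.
  have elw : `|dual_fun ell w| <= 1.
    rewrite (le_trans (dual_norm_ub _ _))// -[leRHS](@mulVf R 2) ?pnatr_eq0//.
    by rewrite ler_pM ?dual_norm_ge0//; exact: ell_le.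
  by rewrite normrM normfV (gtr0_norm q1) ler_pdivrMr// mul1r (le_trans elw)// lerDl ltW.
have [n [ns fn]] : exists n, (sharpness n)^-1 <= 1 - s /\ `|xi f - f (eta n)| <= e.
  have h1 : \forall n \near U, (sharpness n)^-1 <= 1 - s.
    by apply: sU; apply: sharpness_inv_near; rewrite subr_gt0.
  have /cvgrPdist_le /(_ e e0) h2 := @xiP f.
  by have [n [? ?]] := filter_ex (filterI h1 h2); exists n.
have yt : ell (w + (- t) *: eta n) = t.
  rewrite dualD dualZ ellq; have -> : dual_fun ell w = t * (1 + q) by rewrite /t divfK ?gt_eqF.
  ring.
have {}pert := pert n t ns phi1 t1 yt.
have {fN} := fN (w + (- t) *: eta n); rewrite perturbedE yt dualD dualZ => fN.
have fw : `|dual_fun f w| <= N * (1 + e) + e.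
  have -> : dual_fun f w = (dual_fun f w + - t * dual_fun f (eta n) + t * xi f) -
      t * (xi f - dual_fun f (eta n)) by ring.
  rewrite (le_trans (ler_normB _ _))// lerD//.
    by rewrite (le_trans fN)// ler_wpM2l// (le_trans pert)// ltW.
  by rewrite normrM (le_trans _ fn)// ler_piMl.
have -> : dual_fun f (Wt phi) = dual_fun f (Wt phi - w) + dual_fun f w by rewrite -dualD subrK.
rewrite (le_trans (ler_normD _ _))//.
have fwphi : `|dual_fun f (Wt phi - w)| <= `|f| * e.
  by rewrite (le_trans (dual_norm_ub _ _))// ler_wpM2l// dual_norm_ge0.
apply: le_trans (lerD fwphi fw) _.
by rewrite le_eqVlt; apply/orP; left; apply/eqP; ring.
Qed.

Lemma perturbed_norming (f : dual (W Phi)) (N : R) : 0 <= N ->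
  (forall y, `|perturbed ell xi y f| <= N * `|perturbed ell xi y|) -> `|f| <= N.
Proof.
move=> N0 fN; have ftuple := perturbed_norming_tuple N0 fN.
apply: dual_norm_le => // w; apply: (@ler_of_small _ _ _ (`|f| + N)) => [|e e0 _].
  by rewrite addr_ge0// dual_norm_ge0.
have [phi wphi] := W_tuple_dense Phi_dense w e0.
have c0 : 0 < `|w| + e by rewrite ltr_wpDl.
have phic : `|Wt phi| <= `|w| + e.
  have -> : Wt phi = w - (w - Wt phi) by rewrite opprB addrC subrK.
  by rewrite (le_trans (ler_normB _ _))// lerD2l ltW.
have fphi : `|dual_fun f (Wt phi)| <= N * (`|w| + e).
  rewrite -ler_pdivrMr// mulrC.
  have cE : Wt (fun j => comb_testfun ((`|w| + e)^-1) (phi j) (scale_testfun 0 (phi j))) =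
      (`|w| + e)^-1 *: Wt phi.
    rewrite W_tuple_comb; have -> : Wt (fun j => scale_testfun 0 (phi j)) = 0; last by rewrite addr0.
    apply/eqP; rewrite -normr_le0; apply/ler_addgt0Pr => r r0; rewrite add0r.
    by apply: W_tuple_norm_le => // j x; rewrite -[X in `|X|]/(0 * phi j x) mul0r normr0 ltW.
  have := ftuple (fun j => comb_testfun ((`|w| + e)^-1) (phi j) (scale_testfun 0 (phi j))).
  rewrite cE normrZ dualZ normrM normfV (gtr0_norm c0); apply.
  by rewrite ler_pdivrMl// mulr1.
have -> : dual_fun f w = dual_fun f (w - Wt phi) + dual_fun f (Wt phi) by rewrite -dualD subrK.
rewrite (le_trans (ler_normD _ _))//.
have fwphi : `|dual_fun f (w - Wt phi)| <= `|f| * e.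
  by rewrite (le_trans (dual_norm_ub _ _))// ler_wpM2l ?dual_norm_ge0// ltW.
apply: le_trans (lerD fwphi fphi) _.
by rewrite le_eqVlt; apply/orP; left; apply/eqP; ring.
Qed.
End Trace.

Lemma W_not_strongly_unique : ~ strongly_unique_predual (W Phi).
Proof.
have [M etaM] := eta_bounded; have [U [PU sU] [xi xiP]] := weak_cluster etaM.
apply: (@perturbation_not_strongly_unique _ _ ell xi).
- rewrite (xi_ell PU sU xiP) gt_eqF// addr_gt0// mulr_gt0 ?invr_gt0 ?peak_mass_gt0//.
- exact: W_embed_closed.
- exact: (xi_not_embedded PU sU xiP).
- exact: ell_neq0.
- exact: (perturbed_norming PU sU xiP).
Qed.
End Main.

Theorem theorem6p3 (R : realType) (d : nat) (d_gt0 : (0 < d)%N)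
    (Phi : set (testfun R d)) (Phi_countable : countable Phi)
    (Phi_ball : Phi `<=` @unit_ball R d) (Phi_dense : sup_dense Phi) :
  ~ strongly_unique_predual (W Phi).
Proof. exact: W_not_strongly_unique (Ordinal d_gt0) Phi Phi_dense. Qed.
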